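(* The extremal rays of the five-dimensional closed convex cone $\mathcal{P}^{s+}_{3,5}$ are exactly the rays $\mathbb{R}_{\ge0}f$ where $f$ is one of the following polynomials: (i) $\mathfrak{e}^A_{t,u}$ with $0\le t\le 7$ and $0\le u\le \mu_A(t)$; (ii) $\mathfrak{e}^B_{t,u}$ with $2\le t<\infty$ and $\mu_B(t)\le u\le 1$; (iii) $\mathfrak{e}^C_t$ with $0\le t\le 2$; (iv) $\mathfrak{e}^D_t$ with $t\in[0,\infty]$; (v) $\mathfrak{e}^E_t$ with $t\in[7,\infty]$; (vi) $U(S_2-S_{1,1})=s_3$. That is, each listed polynomial is an extremal element of $\mathcal{P}^{s+}_{3,5}$, and every extremal element of $\mathcal{P}^{s+}_{3,5}$ is a positive multiple of one of them.
   Context: Let $a,b,c$ be variables. For nonnegative integers $m,n$ put $S_{m,n}=a^mb^n+b^mc^n+c^ma^n$, $S_n=S_{n,0}=a^n+b^n+c^n$, $T_{m,n}=S_{m,n}+S_{n,m}$, $U=abc$ (so $S_{1,1}=ab+bc+ca$). Let $\mathcal{H}^s_{3,5}$ be the real vector space of symmetric homogeneous polynomials of degree 5 in $\mathbb{R}[a,b,c]$; it has basis $s_0=S_5-US_{1,1}$, $s_1=T_{4,1}-2US_{1,1}$, $s_2=T_{3,2}-2US_{1,1}$, $s_3=US_2-US_{1,1}$, $s_4=US_{1,1}$. Let $\mathcal{P}^{s+}_{3,5}=\{f\in\mathcal{H}^s_{3,5}: f(a,b,c)\ge 0\text{ for all }a,b,c\ge0\}$. For a closed convex cone $\mathcal{P}$,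 an element $f\in\mathcal{P}\setminus\{0\}$ is extremal if whenever $f=g+h$ with $g,h\in\mathcal{P}$ we have $g,h\in\mathbb{R}_{\ge0}f$; $\mathbb{R}_{\ge0}f$ is then an extremal ray. Auxiliary functions: $\mu_L(t)=9(t-1)^2$, $\mu_H(t)=(t+2)(7-t)$, $\mu_A(t)=\min\{\mu_L(t),\mu_H(t)\}$, $\mu_R(t)=2-t^2+t\sqrt{(t-1)(t+2)}$, $\mu_B(t)=\tfrac12\big(\mu_R(t)-\sqrt{\mu_R(t)^2-4}\big)$ (for $t\ge2$), $\mu_Z(t,u)=\frac{(t+2)(7-t)-u}{(t+2)(5t+1)}$, $\omega(u)=u+\frac1u-2$. Family A: for $u>0$, $\mathfrak{e}^A_{t,u}=s_0+\sum_{i=1}^4p^A_i(t,u)s_i$ where $p^A_1=\dfrac{u^2-(t+2)(5t^2+t+9)u+9(t-1)^2(t+2)^2}{(5t+1)(t+2)u}$, $p^A_2=\dfrac{-t^2u^3+(t-1)(7t^3-t^2+11t+1)u^2+(t+2)(17t^5-25t^4+199t^3-59t^2+76t+8)u+9(t-1)^4(t+2)^2(t^2-12t-1)}{(5t+1)^3(t+2)u}$, $p^A_3=\dfrac{(2t^3+4t^2+5t+1)u^3-2(t+2)(7t^4+42t^3+37t^2+48t+10)u^2+(t+2)^2(91t^5+125t^4+682t^3+182t^2+523t+125)u-18(t-1)^2(t+2)^3(t^4+36t^3+34t^2+60t+13)}{(t+2)^2(5t+1)^3u}$, $p^A_4=\dfrac{(t-1)^3(6t^2+6t-12+u)^3}{(t+2)^2(5t+1)^3u}$;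 and $\mathfrak{e}^A_{t,0}=(5t+1)^2s_1+(t-1)^2(t^2-12t-1)s_2-2(t^4+36t^3+34t^2+60t+13)s_3+24(t-1)^4s_4$. Family B: with $p^B_1(t,w)=-2w-3$, $p^B_2(t,w)=w^2+2w+2$, $p^B_3(t,w)=-\frac{2t^3+4t^2+5t+1}{t^2(t+2)}w^2+\frac{2(4t^2+5t+3)}{t+2}w-\frac{3t^3-7t^2-12t-8}{t+2}$, $p^B_4(t,w)=\frac{(t-1)^3(-w^2-2t^2w+t^2(t-2))}{t^2(t+2)}$, put $\mathfrak{e}^B_{t,u}=s_0+\sum_{i=1}^4p^B_i(t,\omega(u))s_i$. Family C: $\mathfrak{e}^C_t=s_0-(t+1)s_1+ts_2+(t+1)^2s_3$. Family D: $\mathfrak{e}^D_t=s_1+(t^2-1)s_2-2(t+1)^2s_3$, and $\mathfrak{e}^D_\infty=s_2-2s_3$. Family E: $\mathfrak{e}^E_t=s_1-s_2-\frac{4t^2+5t+3}{t+2}s_3+\frac{(t-1)^3}{t+2}s_4$, and $\mathfrak{e}^E_\infty=s_4$. *)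

(* Defs.v *)
From Stdlib Require Import Reals.
Open Scope R_scope.

Definition S2 (m n : nat) (a b c : R) : R := a^m * b^n + b^m * c^n + c^m * a^n.
Definition S1 (n : nat) (a b c : R) : R := S2 n 0 a b c.
Definition T2 (m n : nat) (a b c : R) : R := S2 m n a b c + S2 n m a b c.
Definition U (a b c : R) : R := a * b * c.

Definition s0 (a b c : R) : R := S1 5 a b c - U a b c * S2 1 1 a b c.
Definition s1 (a b c : R) : R := T2 4 1 a b c - 2 * U a b c * S2 1 1 a b c.
Definition s2 (a b c : R) : R := T2 3 2 a b c - 2 * U a b c * S2 1 1 a b c.
Definition s3 (a b c : R) : R := U a b c * S1 2 a b c - U a b c * S2 1 1 a b c.
Definition s4 (a b c : R) : R := U a b c * S2 1 1 a b c.

(* An element of H^s_{3,5}, given by its coordinates in the basis s_0..s_4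
   (the map of coordinates to polynomials is a linear isomorphism). *)
Record H35 : Type := mkH35 { c0 : R; c1 : R; c2 : R; c3 : R; c4 : R }.

Definition evalH (f : H35) (a b c : R) : R :=
  c0 f * s0 a b c + c1 f * s1 a b c + c2 f * s2 a b c
  + c3 f * s3 a b c + c4 f * s4 a b c.

Definition addH (f g : H35) : H35 :=
  mkH35 (c0 f + c0 g) (c1 f + c1 g) (c2 f + c2 g) (c3 f + c3 g) (c4 f + c4 g).
Definition scaleH (l : R) (f : H35) : H35 :=
  mkH35 (l * c0 f) (l * c1 f) (l * c2 f) (l * c3 f) (l * c4 f).
Definition zeroH : H35 := mkH35 0 0 0 0 0.

Definition inP (f : H35) : Prop :=
  forall a b c : R, 0 <= a -> 0 <= b -> 0 <= c -> 0 <= evalH f a b c.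

Definition extremal (f : H35) : Prop :=
  inP f /\ f <> zeroH /\
  forall g h : H35, inP g -> inP h -> f = addH g h ->
    (exists l, 0 <= l /\ g = scaleH l f) /\ (exists l, 0 <= l /\ h = scaleH l f).

Definition mu_L (t : R) : R := 9 * (t - 1)^2.
Definition mu_H (t : R) : R := (t + 2) * (7 - t).
Definition mu_A (t : R) : R := Rmin (mu_L t) (mu_H t).
Definition mu_R (t : R) : R := 2 - t^2 + t * sqrt ((t - 1) * (t + 2)).
Definition mu_B (t : R) : R := / 2 * (mu_R t - sqrt (mu_R t ^ 2 - 4)).
Definition omega (u : R) : R := u + / u - 2.

Definition pA1 (t u : R) : R :=
  (u^2 - (t+2)*(5*t^2+t+9)*u + 9*(t-1)^2*(t+2)^2) / ((5*t+1)*(t+2)*u).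
Definition pA2 (t u : R) : R :=
  (- t^2 * u^3 + (t-1)*(7*t^3 - t^2 + 11*t + 1)*u^2
   + (t+2)*(17*t^5 - 25*t^4 + 199*t^3 - 59*t^2 + 76*t + 8)*u
   + 9*(t-1)^4*(t+2)^2*(t^2 - 12*t - 1)) / ((5*t+1)^3*(t+2)*u).
Definition pA3 (t u : R) : R :=
  ((2*t^3 + 4*t^2 + 5*t + 1)*u^3
   - 2*(t+2)*(7*t^4 + 42*t^3 + 37*t^2 + 48*t + 10)*u^2
   + (t+2)^2*(91*t^5 + 125*t^4 + 682*t^3 + 182*t^2 + 523*t + 125)*u
   - 18*(t-1)^2*(t+2)^3*(t^4 + 36*t^3 + 34*t^2 + 60*t + 13))
  / ((t+2)^2*(5*t+1)^3*u).
Definition pA4 (t u : R) : R :=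
  ((t-1)^3*(6*t^2 + 6*t - 12 + u)^3) / ((t+2)^2*(5*t+1)^3*u).

Definition eA (t u : R) : H35 :=
  mkH35 1 (pA1 t u) (pA2 t u) (pA3 t u) (pA4 t u).
Definition eA0 (t : R) : H35 :=
  mkH35 0 ((5*t+1)^2) ((t-1)^2*(t^2 - 12*t - 1))
        (-2*(t^4 + 36*t^3 + 34*t^2 + 60*t + 13)) (24*(t-1)^4).

Definition pB1 (t w : R) : R := -2*w - 3.
Definition pB2 (t w : R) : R := w^2 + 2*w + 2.
Definition pB3 (t w : R) : R :=
  - (2*t^3 + 4*t^2 + 5*t + 1) / (t^2*(t+2)) * w^2
  + 2*(4*t^2 + 5*t + 3) / (t+2) * w
  - (3*t^3 - 7*t^2 - 12*t - 8) / (t+2).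
Definition pB4 (t w : R) : R :=
  ((t-1)^3 * (- w^2 - 2*t^2*w + t^2*(t-2))) / (t^2*(t+2)).
Definition eB (t u : R) : H35 :=
  let w := omega u in mkH35 1 (pB1 t w) (pB2 t w) (pB3 t w) (pB4 t w).

Definition eC (t : R) : H35 := mkH35 1 (-(t+1)) t ((t+1)^2) 0.
Definition eD (t : R) : H35 := mkH35 0 1 (t^2 - 1) (-2*(t+1)^2) 0.
Definition eDinf : H35 := mkH35 0 0 1 (-2) 0.
Definition eE (t : R) : H35 :=
  mkH35 0 1 (-1) (-(4*t^2 + 5*t + 3)/(t+2)) ((t-1)^3/(t+2)).
Definition eEinf : H35 := mkH35 0 0 0 0 1.
Definition eVI : H35 := mkH35 0 0 0 1 0.

Definition listed (f : H35) : Prop :=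
  (exists t u, 0 <= t <= 7 /\ 0 < u <= mu_A t /\ f = eA t u)
  \/ (exists t, 0 <= t <= 7 /\ f = eA0 t)
  \/ (exists t u, 2 <= t /\ mu_B t <= u <= 1 /\ f = eB t u)
  \/ (exists t, 0 <= t <= 2 /\ f = eC t)
  \/ (exists t, 0 <= t /\ f = eD t)
  \/ f = eDinf
  \/ (exists t, 7 <= t /\ f = eE t)
  \/ f = eEinf
  \/ f = eVI.

(* Main.v *)
(** A symmetric quintic is affine in [abc] once [a+b+c] and [ab+bc+ca] are fixed, so [f] is
    nonnegative on the orthant iff two univariate polynomials are nonnegative on [0, oo):
    the quintic [phi f] given by [f(x,1,1)] and the quadratic [psi f] describing [f(0,b,c)].
    An element is extremal when the zeros of [phi f] and [psi f], counted with multiplicity,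
    leave a one-dimensional space.  For the listed forms, [0 <= phi g <= phi f] transfers the
    double zeros to every summand [g].  Conversely, if [f] is extremal then either a small
    multiple of one of the simple forms [s4], [s3] or [eE t] can be subtracted from (or added to)
    [f], so that [f] is proportional to it, or [f] has a further double zero; two double zeros
    of [phi f] lead to family A, one of [phi f] and one of [psi f] to family B, and a zero at
    [x = 1] to families C, D or B. *)

From Stdlib Require Import Reals Lra Lia Psatz List Classical.
Require Import Defs.
Import ListNotations.
Open Scope R_scope.

(** * Polynomials on the half-line *)

(** The quintics [phi f] fill a hyperplane, cut out by 5 p(1) = 3 p'(1), and this relation shapes
    the classification. Two double zeros leave a linear cofactor, and the relation fixes the ratio
    of its two coefficients: this is the origin of the rational functions in family A. One double
    zero leaves a cubic cofactor; a double zero w of [psi f] fixes three of its coefficients up to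
    scale and the relation fixes the fourth, which gives family B. About a nonnegative quintic that
    vanishes at 1 the relation says nothing, because such a zero is double anyway. As [phi f] takes
    the value [3 * c4 f] at 1, the case [c4 f = 0] has to be treated apart. On the face a = 0 the
    parameter w = (b-c)^2/(bc) turns f into a quadratic, and [omega u] is its value at b/c = u.
    Since [phi] is injective, proportionality can be checked on [phi] alone. *)

Fixpoint peval (p : list R) (x : R) : R :=
  match p with
  | [] => 0
  | a :: q => a + x * peval q x
  end.

Definition nonneg_ray (p : list R) : Prop := forall x, 0 <= x -> 0 <= peval p x.

Lemma continuity_cst (a : R) : continuity (fun _ => a).
Proof. apply continuity_const; intros x y; reflexivity. Qed.

Lemma continuity_id : continuity (fun x => x).
Proof. apply derivable_continuous, derivable_id. Qed.

Lemma peval_continuity p : continuity (peval p).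
Proof.
  induction p as [|a p IH]; simpl.
  - apply continuity_cst.
  - apply continuity_plus; [apply continuity_cst|].
    apply continuity_mult; [apply continuity_id | exact IH].
Qed.

(** One-sided, so that it also applies at the end point 0 of the half-line. *)
Lemma right_limit_nonneg (F : R -> R) (t d : R) :
  continuity F -> 0 < d -> (forall x, t < x < t + d -> 0 <= F x) -> 0 <= F t.
Proof.
  intros HF Hd H.
  destruct (Rle_lt_dec 0 (F t)) as [H0|H0]; [exact H0|exfalso].
  destruct (HF t (- F t)) as [e [He He']]; [lra|].
  assert (M : 0 < Rmin e d) by (now apply Rmin_pos).
  assert (Me := Rmin_l e d). assert (Md := Rmin_r e d).
  specialize (He' (t + Rmin e d / 2)). specialize (H (t + Rmin e d / 2) ltac:(lra)).
  simpl in He'. unfold R_dist, D_x, no_cond in He'.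
  specialize (He' ltac:(split; [split; [exact I|lra]|rewrite Rabs_right; lra])).
  apply Rabs_def2 in He'. lra.
Qed.

Lemma continuous_nonneg_at (F : R -> R) (t : R) :
  continuity F -> 0 <= t ->
  (forall x, 0 <= x -> x <> t -> 0 <= F x) -> 0 <= F t.
Proof.
  intros HF Ht H. apply (right_limit_nonneg F t 1 HF); [lra|].
  intros x Hx; apply H; lra.
Qed.

Lemma factor_root p t :
  exists q, length q = pred (length p) /\
    forall x, peval p x = (x - t) * peval q x + peval p t.
Proof.
  induction p as [|a p [q [Hl Hq]]].
  - exists []; split; [reflexivity|intros x; simpl; ring].
  - destruct p as [|b p].
    + exists []; split; [reflexivity|intros x; simpl; ring].
    + exists (peval (b :: p) t :: q); split; [simpl in *; now rewrite Hl|].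
      intros x. change (a + x * peval (b :: p) x
        = (x - t) * (peval (b :: p) t + x * peval q x) + (a + t * peval (b :: p) t)).
      rewrite (Hq x) at 1. ring.
Qed.

(** To the right of t the quotient p/(x-t) is squeezed between 0 and (x-t)F, so it vanishes at t as
    well. Only the right side is used, which admits t = 0. This is how a summand inherits double
    zeros. *)
Lemma sandwich_square p (F : R -> R) t :
  0 <= t -> continuity F ->
  (forall x, 0 <= x -> 0 <= peval p x <= (x - t)^2 * F x) ->
  exists q, length q = pred (pred (length p)) /\
    (forall x, peval p x = (x - t)^2 * peval q x) /\
    (forall x, 0 <= x -> 0 <= peval q x <= F x).
Proof.
  intros Ht HF H.
  destruct (factor_root p t) as [p1 [L1 H1]].
  assert (P0 : peval p t = 0).
  { specialize (H t Ht). replace ((t - t)^2 * F t) with 0 in H by ring. lra. }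
  assert (C1 := peval_continuity p1).
  assert (R1 : forall x, t < x -> 0 <= peval p1 x <= (x - t) * F x).
  { intros x Hx. specialize (H x ltac:(lra)). rewrite H1, P0 in H.
    split; apply Rmult_le_reg_l with (x - t); lra. }
  assert (Q0 : peval p1 t = 0).
  { apply Rle_antisym.
    - enough (0 <= (t - t) * F t - peval p1 t) by lra.
      apply (right_limit_nonneg (fun x => (x - t) * F x - peval p1 x) t 1); [|lra|].
      + apply continuity_minus; [|exact C1]. apply continuity_mult; [|exact HF].
        apply continuity_minus; [apply continuity_id|apply continuity_cst].
      + intros x Hx. specialize (R1 x ltac:(lra)). lra.
    - apply (right_limit_nonneg _ t 1 C1); [lra|]. intros x Hx. apply R1; lra. }
  destruct (factor_root p1 t) as [q [L2 H2]].
  assert (E : forall x, peval p x = (x - t)^2 * peval q x).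
  { intros x. rewrite H1, H2, P0, Q0. ring. }
  assert (N : forall x, 0 <= x -> x <> t -> 0 <= peval q x <= F x).
  { intros x Hx Hxt. specialize (H x Hx). rewrite E in H.
    assert (0 < (x - t)^2) by nra.
    split; apply Rmult_le_reg_l with ((x - t)^2); lra. }
  exists q. split; [now rewrite L2, L1|]. split; [exact E|].
  intros x Hx. destruct (Req_dec x t) as [->|Hxt]; [|now apply N].
  assert (Cq := peval_continuity q). split.
  - apply continuous_nonneg_at; trivial. intros; now apply N.
  - enough (0 <= F t - peval q t) by lra.
    apply (continuous_nonneg_at (fun x => F x - peval q x)); trivial.
    + now apply continuity_minus.
    + intros y Hy Hyt. specialize (N y Hy Hyt). lra.
Qed.

Lemma positive_zero_factor p t :
  0 < t -> nonneg_ray p -> peval p t = 0 ->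
  exists q, length q = pred (pred (length p)) /\
    (forall x, peval p x = (x - t)^2 * peval q x) /\ nonneg_ray q.
Proof.
  intros Ht H P0.
  destruct (factor_root p t) as [p1 [L1 H1]].
  assert (E1 : forall x, peval p x = (x - t) * peval p1 x) by (intros; rewrite H1, P0; ring).
  assert (C1 := peval_continuity p1).
  assert (Q0 : peval p1 t = 0).
  { apply Rle_antisym.
    (* A left limit, taken as a right limit after the reflection x -> 2t - x; the radius t keeps the
       argument positive. *)
    - enough (0 <= - peval p1 (2 * t - t))
        by (replace (2 * t - t) with t in * by ring; lra).
      apply (right_limit_nonneg (fun x => - peval p1 (2 * t - x)) t t); [|lra|].
      + apply continuity_opp.
        apply (continuity_comp (fun x => 2 * t - x) (peval p1)); [|exact C1].
        apply continuity_minus; [apply continuity_cst|apply continuity_id].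
      + intros x Hx. specialize (H (2 * t - x) ltac:(lra)). rewrite E1 in H.
        apply Rmult_le_reg_l with (x - t); lra.
    - apply (right_limit_nonneg _ t 1 C1); [lra|]. intros x Hx.
      specialize (H x ltac:(lra)). rewrite E1 in H.
      apply Rmult_le_reg_l with (x - t); lra. }
  destruct (factor_root p1 t) as [q [L2 H2]].
  assert (E : forall x, peval p x = (x - t)^2 * peval q x).
  { intros x. rewrite E1, H2, Q0. ring. }
  exists q. split; [now rewrite L2, L1|]. split; [exact E|].
  assert (N : forall x, 0 <= x -> x <> t -> 0 <= peval q x).
  { intros x Hx Hxt. specialize (H x Hx). rewrite E in H.
    apply Rmult_le_reg_l with ((x - t)^2); nra. }
  intros x Hx. destruct (Req_dec x t) as [->|Hxt]; [|now apply N].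
  apply continuous_nonneg_at; trivial. apply peval_continuity.
Qed.

(** * Lower bounds from the order at 0 and the degree *)

Lemma low_order_bound k : forall p,
  (forall x, 0 < x <= 1 -> 0 < peval p x) ->
  (exists i, (i <= k)%nat /\ nth i p 0 <> 0) ->
  exists e, 0 < e /\ forall x, 0 <= x <= 1 -> e * x^k <= peval p x.
Proof.
  induction k as [|k IH]; intros [|a p] Hpos [i [Hi Hne]];
    try (destruct i; simpl in Hne; contradiction);
    destruct (Req_dec a 0) as [Ha|Ha];
    try (destruct i; [contradiction|lia]).
  (* A vanishing constant coefficient allows division by x. Otherwise the polynomial is positive on
     the compact interval [0,1], and its minimum serves as e. *)
  2: { destruct (IH p) as [e [He Hb]].
    - intros x Hx. specialize (Hpos x Hx). simpl in Hpos. nra.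
    - destruct i as [|i]; [contradiction|]. exists i. split; [lia|exact Hne].
    - exists e. split; [exact He|]. intros x Hx. specialize (Hb x Hx).
      simpl. rewrite Ha. nra. }
  all: assert (Q : 0 < peval (a :: p) 0);
    [ assert (0 <= peval (a :: p) 0);
      [ apply (right_limit_nonneg _ 0 1 (peval_continuity _)); [lra|];
        intros x Hx; apply Rlt_le, Hpos; lra
      | simpl in *; lra ] |];
    destruct (continuity_ab_min (peval (a :: p)) 0 1) as [m [Hm Hm']];
    [lra | intros; apply peval_continuity |];
    assert (E : 0 < peval (a :: p) m)
      by (destruct (Req_dec m 0) as [->|]; [exact Q|apply Hpos; lra]);
    exists (peval (a :: p) m); split; [exact E|];
    intros x Hx; specialize (Hm x Hx).
  - simpl pow. lra.
  - assert (0 <= x^S k <= 1).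
    { split; [apply pow_le; lra|]. rewrite <- (pow1 (S k)). apply pow_incr; lra. }
    nra.
Qed.

Lemma peval_app p q x : peval (p ++ q) x = peval p x + x ^ length p * peval q x.
Proof. induction p as [|a p IH]; simpl; [ring|rewrite IH; ring]. Qed.

Lemma peval_rev p x : x <> 0 -> x * peval p x = x ^ length p * peval (rev p) (/ x).
Proof.
  intros Hx. induction p as [|a p IH]; [simpl; ring|].
  simpl rev. rewrite peval_app, length_rev. simpl.
  rewrite Rmult_plus_distr_l, IH.
  replace (/ x ^ length p) with ((/ x) ^ length p) by (apply pow_inv).
  rewrite pow_inv. field. split; [exact Hx|now apply pow_nonzero].
Qed.

(** The inversion x -> 1/x reverses the coefficient list and moves the behaviour at infinity to
    0. *)
Lemma high_order_bound k p :
  (forall x, 1 <= x -> 0 < peval p x) ->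
  (exists i, (k <= i < length p)%nat /\ nth i p 0 <> 0) ->
  exists e, 0 < e /\ forall x, 1 <= x -> e * x^k <= peval p x.
Proof.
  intros Hpos [i [Hi Hne]].
  set (n := length p) in *.
  destruct (low_order_bound (n - S k) (rev p)) as [e [He Hb]].
  - intros y Hy. assert (Hy1 : 1 <= / y) by (rewrite <- Rinv_1; apply Rinv_le_contravar; lra).
    specialize (Hpos (/ y) Hy1).
    assert (E := peval_rev p (/ y) ltac:(lra)). rewrite Rinv_inv in E.
    apply Rmult_lt_reg_l with ((/ y) ^ length p); [apply pow_lt; lra|].
    rewrite <- E, Rmult_0_r. apply Rmult_lt_0_compat; lra.
  - exists (n - S i)%nat. split; [lia|].
    rewrite rev_nth by (fold n; lia). fold n.
    replace (n - S (n - S i))%nat with i by lia. exact Hne.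
  - exists e. split; [exact He|]. intros x Hx.
    assert (0 < / x) by (apply Rinv_0_lt_compat; lra).
    assert (/ x <= 1) by (rewrite <- Rinv_1; apply Rinv_le_contravar; lra).
    specialize (Hb (/ x) ltac:(lra)).
    assert (E := peval_rev p x ltac:(lra)). fold n in E.
    apply Rmult_le_reg_l with x; [lra|]. rewrite E.
    apply Rle_trans with (x ^ n * (e * (/ x) ^ (n - S k))).
    + right. replace n with (S k + (n - S k))%nat at 1 by lia.
      rewrite pow_add, pow_inv. simpl pow. field. apply pow_nonzero; lra.
    + apply Rmult_le_compat_l; [apply pow_le; lra|exact Hb].
Qed.

(** The room needed for perturbations: x controls the sum on [0,1] and x^k controls it beyond,
    whence the factor 1/2 in e. *)
Lemma ray_lower_bound k p :
  (1 <= k)%nat -> (forall x, 0 < x -> 0 < peval p x) ->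
  nth 0 p 0 <> 0 \/ nth 1 p 0 <> 0 ->
  (exists i, (k <= i < length p)%nat /\ nth i p 0 <> 0) ->
  exists e, 0 < e /\ forall x, 0 <= x -> e * (x + x^k) <= peval p x.
Proof.
  intros Hk Hpos H0 Hi.
  destruct (low_order_bound 1 p) as [e [He Hb]].
  { intros x Hx; apply Hpos; lra. }
  { destruct H0; [exists 0%nat|exists 1%nat]; split; auto. }
  destruct (high_order_bound k p) as [e' [He' Hb']]; [intros x Hx; apply Hpos; lra|exact Hi|].
  assert (M := Rmin_pos _ _ He He').
  assert (M1 := Rmin_l e e'). assert (M2 := Rmin_r e e').
  exists (Rmin e e' / 2). split; [lra|]. intros x Hx.
  assert (Hp : 0 <= x ^ k) by (now apply pow_le).
  destruct (Rle_lt_dec x 1) as [L|L].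
  - specialize (Hb x ltac:(lra)). rewrite pow_1 in Hb.
    assert (x ^ k <= x).
    { destruct k as [|k]; [lia|]. simpl.
      assert (x ^ k <= 1) by (rewrite <- (pow1 k); apply pow_incr; lra).
      assert (0 <= x ^ k) by (now apply pow_le). nra. }
    nra.
  - specialize (Hb' x ltac:(lra)).
    assert (x <= x ^ k).
    { destruct k as [|k]; [lia|]. simpl. assert (1 <= x ^ k) by (apply pow_R1_Rle; lra). nra. }
    nra.
Qed.

(** The last entry is the value at 0 of the reversed polynomial, which is nonnegative at every y > 0
    by [peval_rev]. *)
Lemma leading_nonneg p a : nonneg_ray (p ++ [a]) -> 0 <= a.
Proof.
  intros H.
  assert (E : peval (rev (p ++ [a])) 0 = a) by (rewrite rev_app_distr; simpl; ring).
  rewrite <- E. apply (right_limit_nonneg _ 0 1 (peval_continuity _)); [lra|].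
  intros y Hy. assert (Hy' : 0 < / y) by (apply Rinv_0_lt_compat; lra).
  specialize (H (/ y) ltac:(lra)).
  assert (F := peval_rev (p ++ [a]) (/ y) ltac:(lra)). rewrite Rinv_inv in F.
  apply Rmult_le_reg_l with ((/ y) ^ length (p ++ [a])); [apply pow_lt; lra|].
  rewrite <- F, Rmult_0_r. apply Rmult_le_pos; lra.
Qed.

Lemma peval_eq6 a0 a1 a2 a3 a4 a5 b0 b1 b2 b3 b4 b5 :
  (forall x, 0 <= x -> peval [a0; a1; a2; a3; a4; a5] x = peval [b0; b1; b2; b3; b4; b5] x) ->
  a0 = b0 /\ a1 = b1 /\ a2 = b2 /\ a3 = b3 /\ a4 = b4 /\ a5 = b5.
Proof.
  intros H. cbn [peval] in H.
  assert (H0 := H 0). assert (H1 := H 1). assert (H2 := H 2).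
  assert (H3 := H 3). assert (H4 := H 4). assert (H5 := H 5). clear H.
  repeat split; lra.
Qed.

(** * The cone in terms of two univariate polynomials *)

(* [phi f] is [x |-> f(x,1,1)]; [psi f] is the restriction of [f] to [a = 0],
   as a function of [w = (b-c)^2/(bc)]. *)
Definition phi (f : H35) : list R :=
  [2 * (c0 f + c1 f + c2 f); - c0 f - 2 * c2 f + c3 f + c4 f;
   -2 * c0 f - 4 * c1 f - 2 * c2 f - 2 * c3 f + 2 * c4 f;
   2 * c2 f + c3 f; 2 * c1 f; c0 f].
Definition psi (f : H35) : list R :=
  [c0 f + c1 f + c2 f; 3 * c0 f + c1 f; c0 f].

Ltac unfold_eval := unfold evalH, s0, s1, s2, s3, s4, T2, S1, S2, U.

Lemma evalH_phi f a b : b <> 0 -> evalH f a b b = b^5 * peval (phi f) (a / b).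
Proof. intros Hb. unfold_eval. simpl. field. exact Hb. Qed.

Lemma evalH_psi f b c :
  b <> 0 -> c <> 0 ->
  evalH f 0 b c = (b + c) * (b * c)^2 * peval (psi f) ((b - c)^2 / (b * c)).
Proof. intros Hb Hc. unfold_eval. simpl. field. split; assumption. Qed.

Lemma evalH_edge f b : evalH f 0 0 b = c0 f * b^5.
Proof. unfold_eval. ring. Qed.

Lemma evalH_rot f a b c : evalH f a b c = evalH f b c a.
Proof. unfold_eval. ring. Qed.

Lemma evalH_swap f a b c : evalH f a b c = evalH f b a c.
Proof. unfold_eval. ring. Qed.

Definition sym_const (f : H35) (s q : R) : R :=
  c0 f * (s^5 - 5 * s^3 * q + 5 * s * q^2) + c1 f * (s^3 * q - 3 * s * q^2)
  + c2 f * (s * q^2).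
Definition sym_slope (f : H35) (s q : R) : R :=
  c0 f * (5 * s^2 - 6 * q) + c1 f * (3 * q - s^2) - c2 f * (2 * s^2 + 3 * q)
  + c3 f * (s^2 - 3 * q) + c4 f * q.

Lemma evalH_affine f a b c s q :
  s = a + b + c -> q = a * b + b * c + c * a ->
  evalH f a b c = sym_const f s q + a * b * c * sym_slope f s q.
Proof. intros -> ->. unfold_eval. unfold sym_const, sym_slope. ring. Qed.

Lemma affine_between (A B l e h : R) :
  l <= e <= h -> 0 <= A + l * B -> 0 <= A + h * B -> 0 <= A + e * B.
Proof. intros. destruct (Rle_lt_dec 0 B); nra. Qed.

Lemma two_equal_nonneg f a b :
  nonneg_ray (phi f) -> nonneg_ray (psi f) -> 0 <= a -> 0 <= b -> 0 <= evalH f a b b.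
Proof.
  intros Hphi Hpsi Ha Hb. destruct (Req_dec b 0) as [->|Hb0].
  - rewrite evalH_rot, evalH_edge.
    assert (H := leading_nonneg [_; _] _ Hpsi).
    apply Rmult_le_pos; [exact H|now apply pow_le].
  - rewrite evalH_phi by exact Hb0. apply Rmult_le_pos; [now apply pow_le|].
    apply Hphi. apply Rmult_le_pos; [exact Ha|]. apply Rlt_le, Rinv_0_lt_compat. lra.
Qed.

Lemma one_zero_nonneg f b c :
  nonneg_ray (psi f) -> 0 <= b -> 0 <= c -> 0 <= evalH f 0 b c.
Proof.
  intros Hpsi Hb Hc.
  assert (H := leading_nonneg [_; _] _ Hpsi).
  destruct (Req_dec b 0) as [->|Hb0].
  { rewrite evalH_edge. apply Rmult_le_pos; [exact H|now apply pow_le]. }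
  destruct (Req_dec c 0) as [->|Hc0].
  { rewrite <- evalH_rot, evalH_edge. apply Rmult_le_pos; [exact H|now apply pow_le]. }
  rewrite evalH_psi by assumption.
  assert (0 < b * c) by (apply Rmult_lt_0_compat; lra).
  apply Rmult_le_pos; [apply Rmult_le_pos; [lra|apply pow2_ge_0]|].
  apply Hpsi. apply Rmult_le_pos; [apply pow2_ge_0|now apply Rlt_le, Rinv_0_lt_compat].
Qed.

(* For fixed [a+b+c] and [ab+bc+ca] the extreme values of [abc] on the orthant
   are attained when two variables coincide or one vanishes. *)
Lemma ordered_nonneg f a b c :
  nonneg_ray (phi f) -> nonneg_ray (psi f) -> 0 <= a <= b -> b <= c -> 0 <= evalH f a b c.
Proof.
  intros Hphi Hpsi Hab Hbc.
  set (s := a + b + c). set (q := a * b + b * c + c * a).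
  assert (D0 : 0 <= s^2 - 3 * q) by (unfold s, q; nra).
  set (r := sqrt (s^2 - 3 * q)).
  assert (Hr : 0 <= r) by apply sqrt_pos.
  assert (Hrr : r * r = s^2 - 3 * q) by (now apply sqrt_sqrt).
  rewrite (evalH_affine f a b c s q) by reflexivity.
  (* The critical points of (T-a)(T-b)(T-c), hence a <= x <= b <= y <= c. The triples (s-2x, x, x)
     and (s-2y, y, y) have the same s and q as (a, b, c), and their products bound abc from above
     and below. *)
  set (x := (s - r) / 3). set (y := (s + r) / 3).
  assert (Hx : x * x * 3 - 2 * s * x + q = 0) by (unfold x; nra).
  assert (Hy : y * y * 3 - 2 * s * y + q = 0) by (unfold y; nra).
  assert (Dx : 3 * (a - x) * (a - y) = (a - b) * (a - c)).
  { replace (3 * (a - x) * (a - y)) with (3 * a^2 - 2 * s * a + (s * s - r * r) / 3)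
      by (unfold x, y; field). rewrite Hrr. unfold s, q. field. }
  assert (Dy : 3 * (b - x) * (b - y) = (b - a) * (b - c)).
  { replace (3 * (b - x) * (b - y)) with (3 * b^2 - 2 * s * b + (s * s - r * r) / 3)
      by (unfold x, y; field). rewrite Hrr. unfold s, q. field. }
  assert (Dz : 3 * (c - x) * (c - y) = (c - a) * (c - b)).
  { replace (3 * (c - x) * (c - y)) with (3 * c^2 - 2 * s * c + (s * s - r * r) / 3)
      by (unfold x, y; field). rewrite Hrr. unfold s, q. field. }
  assert (Hxy : x <= y) by (unfold x, y; lra).
  assert (Sxy : x + y + (x + y) / 2 = s) by (unfold x, y; lra).
  assert (Hax : a <= x).
  { destruct (Rle_lt_dec a x) as [?|L]; [assumption|exfalso].
    assert (a < y) by (unfold s in *; lra). nra. }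
  assert (Hxb : x <= b).
  { destruct (Rle_lt_dec x b) as [?|L]; [assumption|exfalso]. nra. }
  assert (Hby : b <= y).
  { destruct (Rle_lt_dec b y) as [?|L]; [assumption|exfalso]. nra. }
  assert (Hyc : y <= c).
  { destruct (Rle_lt_dec y c) as [?|L]; [assumption|exfalso].
    assert (x < c) by (unfold s in *; lra). nra. }
  assert (Ex : a * b * c - x * x * (s - 2 * x) = (a - x) * (b - x) * (c - x)).
  { replace (x * x * (s - 2 * x)) with (x^3 - s * x^2 + q * x - x * (x * x * 3 - 2 * s * x + q)) by ring.
    rewrite Hx. unfold s, q. ring. }
  assert (Ey : a * b * c - y * y * (s - 2 * y) = (a - y) * (b - y) * (c - y)).
  { replace (y * y * (s - 2 * y)) with (y^3 - s * y^2 + q * y - y * (y * y * 3 - 2 * s * y + q)) by ring.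
    rewrite Hy. unfold s, q. ring. }
  assert (Ux : a * b * c <= x * x * (s - 2 * x)).
  { assert (0 <= (x - a) * ((b - x) * (c - x)))
      by (apply Rmult_le_pos; [lra|apply Rmult_le_pos; lra]). lra. }
  assert (Uy : y * y * (s - 2 * y) <= a * b * c).
  { assert (0 <= (y - a) * ((y - b) * (c - y)))
      by (apply Rmult_le_pos; [lra|apply Rmult_le_pos; lra]). lra. }
  assert (Vx : 0 <= sym_const f s q + x * x * (s - 2 * x) * sym_slope f s q).
  { replace (x * x * (s - 2 * x)) with ((s - 2 * x) * x * x) by ring.
    rewrite <- evalH_affine by lra. apply two_equal_nonneg; trivial; lra. }
  destruct (Rle_lt_dec 0 (s - 2 * y)) as [P|P].
  - apply affine_between with (y * y * (s - 2 * y)) (x * x * (s - 2 * x)); trivial; [lra|].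
    replace (y * y * (s - 2 * y)) with ((s - 2 * y) * y * y) by ring.
    rewrite <- evalH_affine by lra. apply two_equal_nonneg; trivial; lra.
  (* Here (s-2y, y, y) leaves the orthant. The lower end becomes abc = 0, attained at (0, (s-d)/2,
     (s+d)/2), which again has the given s and q. *)
  - apply affine_between with 0 (x * x * (s - 2 * x)); trivial.
    { split; [|exact Ux]. apply Rmult_le_pos; [apply Rmult_le_pos|]; lra. }
    assert (Hsr : s < 2 * r) by (unfold y in P; lra).
    assert (D1 : 0 <= s^2 - 4 * q) by nra.
    set (d := sqrt (s^2 - 4 * q)).
    assert (Hd : 0 <= d) by apply sqrt_pos.
    assert (Hdd : d * d = s^2 - 4 * q) by (now apply sqrt_sqrt).
    assert (Hq : 0 <= q).
    { unfold q. assert (0 <= a * b) by (apply Rmult_le_pos; lra).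
      assert (0 <= b * c) by (apply Rmult_le_pos; lra).
      assert (0 <= c * a) by (apply Rmult_le_pos; lra). lra. }
    assert (Hs : 0 <= s) by (unfold s; lra).
    assert (Hds : d <= s) by nra.
    replace (0 * sym_slope f s q) with (0 * ((s - d) / 2) * ((s + d) / 2) * sym_slope f s q) by ring.
    rewrite <- evalH_affine by lra. apply one_zero_nonneg; trivial; lra.
Qed.

Lemma inP_iff f : inP f <-> nonneg_ray (phi f) /\ nonneg_ray (psi f).
Proof.
  split.
  - intros H. split.
    + intros x Hx. assert (E := evalH_phi f x 1 ltac:(lra)).
      rewrite Rdiv_1_r in E. specialize (H x 1 1 Hx ltac:(lra) ltac:(lra)).
      rewrite E, pow1 in H. lra.
    (* Solving (x-1)^2 = w x gives a point (0, x, 1) with parameter w. *)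
    + intros w Hw. set (d := sqrt (w^2 + 4 * w)).
      assert (Hd : 0 <= d) by apply sqrt_pos.
      assert (Hdd : d * d = w^2 + 4 * w) by (apply sqrt_sqrt; nra).
      set (x := (w + 2 + d) / 2).
      assert (Hx : 0 < x) by (unfold x; lra).
      assert (Exx : (x - 1)^2 = w * x) by (unfold x; nra).
      assert (E := evalH_psi f x 1 ltac:(lra) ltac:(lra)).
      rewrite Exx in E. replace (w * x / (x * 1)) with w in E by (field; lra).
      specialize (H 0 x 1 ltac:(lra) ltac:(lra) ltac:(lra)). rewrite E in H.
      apply Rmult_le_reg_l with ((x + 1) * (x * 1)^2); [|lra].
      apply Rmult_lt_0_compat; [lra|]. apply pow_lt; lra.
  - intros [Hphi Hpsi] a b c Ha Hb Hc.
    assert (K := ordered_nonneg f).    destruct (Rle_lt_dec a b), (Rle_lt_dec b c), (Rle_lt_dec a c);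
      solve [ apply K; trivial; lra
            | rewrite evalH_swap; apply K; trivial; lra
            | rewrite evalH_rot; apply K; trivial; lra
            | rewrite evalH_rot, evalH_rot; apply K; trivial; lra
            | rewrite evalH_swap, evalH_rot; apply K; trivial; lra
            | rewrite evalH_swap, evalH_rot, evalH_rot; apply K; trivial; lra ].
Qed.

(** * Extremality of the listed forms *)

Lemma H35_eq f g :
  c0 f = c0 g -> c1 f = c1 g -> c2 f = c2 g -> c3 f = c3 g -> c4 f = c4 g -> f = g.
Proof. destruct f, g; simpl; intros; subst; reflexivity. Qed.

Lemma phi_add g h x : peval (phi (addH g h)) x = peval (phi g) x + peval (phi h) x.
Proof. simpl. ring. Qed.

Lemma psi_add g h x : peval (psi (addH g h)) x = peval (psi g) x + peval (psi h) x.
Proof. simpl. ring. Qed.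

Lemma phi_scale l g x : peval (phi (scaleH l g)) x = l * peval (phi g) x.
Proof. simpl. ring. Qed.

Lemma psi_scale l g x : peval (psi (scaleH l g)) x = l * peval (psi g) x.
Proof. simpl. ring. Qed.

(* The last equation is [5 phi(1) = 3 phi'(1)], the only linear relation on the image of [phi]. *)
Lemma phi_coords f b0 b1 b2 b3 b4 b5 :
  (forall x, 0 <= x -> peval (phi f) x = peval [b0; b1; b2; b3; b4; b5] x) ->
  c0 f = b5 /\ c1 f = b4 / 2 /\ c2 f = b0 / 2 - b4 / 2 - b5 /\
  c3 f = b3 - b0 + b4 + 2 * b5 /\ c4 f = (b0 + b1 + b2 + b3 + b4 + b5) / 3 /\
  5 * b0 + 2 * b1 - b2 - 4 * b3 - 7 * b4 - 10 * b5 = 0.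
Proof.
  intros H. unfold phi in H. apply peval_eq6 in H.
  destruct H as [H0 [H1 [H2 [H3 [H4 H5]]]]]. repeat split; lra.
Qed.

Lemma phi_inj f g l :
  (forall x, 0 <= x -> peval (phi f) x = l * peval (phi g) x) -> f = scaleH l g.
Proof.
  intros H.
  assert (H' : forall x, 0 <= x -> peval (phi f) x = peval (phi (scaleH l g)) x)
    by (intros; rewrite phi_scale; auto).
  unfold phi in H' at 2. apply phi_coords in H'. simpl in H'.
  destruct H' as [H0 [H1 [H2 [H3 [H4 _]]]]].
  apply H35_eq; simpl; lra.
Qed.

Lemma inP_scale l f : 0 <= l -> inP f -> inP (scaleH l f).
Proof.
  intros Hl [Hp Hs]%inP_iff. apply inP_iff. split; intros x Hx.
  - rewrite phi_scale. apply Rmult_le_pos; auto.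
  - rewrite psi_scale. apply Rmult_le_pos; auto.
Qed.

Lemma scale_scale k l f : scaleH k (scaleH l f) = scaleH (k * l) f.
Proof. apply H35_eq; simpl; ring. Qed.

Lemma scale_one f : scaleH 1 f = f.
Proof. apply H35_eq; simpl; ring. Qed.

Lemma scale_ne0 l f : l <> 0 -> f <> zeroH -> scaleH l f <> zeroH.
Proof.
  intros Hl Hf E. apply Hf.
  rewrite <- (scale_one f), <- (Rinv_l l Hl), <- scale_scale, E.
  apply H35_eq; simpl; ring.
Qed.

Lemma inP_pointed l f : inP f -> f <> zeroH -> inP (scaleH l f) -> 0 <= l.
Proof.
  intros [Hf _]%inP_iff H0 [Hl _]%inP_iff.
  destruct (Rle_lt_dec 0 l) as [?|L]; [assumption|exfalso]. apply H0.
  replace zeroH with (scaleH 0 f) by (apply H35_eq; simpl; ring).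
  apply phi_inj. intros x Hx. specialize (Hf x Hx). specialize (Hl x Hx).
  rewrite phi_scale in Hl. nra.
Qed.

Definition dominated (g f : H35) : Prop :=
  (forall x, 0 <= x -> 0 <= peval (phi g) x <= peval (phi f) x) /\
  (forall w, 0 <= w -> 0 <= peval (psi g) w <= peval (psi f) w).

Lemma dominated_summand f g h : inP g -> inP h -> f = addH g h -> dominated g f.
Proof.
  intros [Gp Gs]%inP_iff [Hp Hs]%inP_iff ->. split; intros x Hx.
  - rewrite phi_add. specialize (Gp x Hx). specialize (Hp x Hx). lra.
  - rewrite psi_add. specialize (Gs x Hx). specialize (Hs x Hx). lra.
Qed.

Lemma extremal_intro f :
  inP f -> f <> zeroH ->
  (forall g, dominated g f -> exists l, g = scaleH l f) -> extremal f.
Proof.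
  intros Hf H0 K.
  assert (K' : forall g h, inP g -> inP h -> f = addH g h ->
             exists l, 0 <= l /\ g = scaleH l f).
  { intros g h Hg Hh E. destruct (K g) as [l ->]; [now apply dominated_summand with h|].
    exists l. split; [|reflexivity]. now apply inP_pointed with f. }
  split; [exact Hf|]. split; [exact H0|]. intros g h Hg Hh E. split.
  - now apply K' with h.
  - apply K' with g; trivial. rewrite E. apply H35_eq; simpl; ring.
Qed.

Lemma extremal_scale l f : 0 < l -> extremal f -> extremal (scaleH l f).
Proof.
  intros Hl [Hf [H0 K]]. split; [|split].
  - apply inP_scale; trivial; lra.
  - apply scale_ne0; trivial; lra.
  - intros g h Hg Hh E.
    assert (Hl' : 0 < / l) by (now apply Rinv_0_lt_compat).
    destruct (K (scaleH (/ l) g) (scaleH (/ l) h)) as [[a [Ha Ea]] [b [Hb Eb]]].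
    + apply inP_scale; trivial; lra.
    + apply inP_scale; trivial; lra.
    + replace (addH (scaleH (/ l) g) (scaleH (/ l) h)) with (scaleH (/ l) (addH g h))
        by (apply H35_eq; simpl; ring).
      rewrite <- E, scale_scale, Rinv_l, scale_one by lra. reflexivity.
    + assert (R : forall k c, scaleH (/ l) k = scaleH c f -> k = scaleH c (scaleH l f)).
      { intros k c E'. rewrite scale_scale, Rmult_comm, <- scale_scale, <- E', scale_scale,
          Rinv_r, scale_one by lra. reflexivity. }
      split; [exists a|exists b]; auto.
Qed.

Ltac poly_continuity :=
  repeat first [ apply continuity_cst | apply continuity_id
    | apply continuity_minus | apply continuity_plus | apply continuity_mult ].

Ltac length_list q L :=
  repeat (destruct q as [|? q]; [discriminate L|]);
  destruct q as [|? q]; [clear L|discriminate L].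

Lemma constant_of_bounded_cubic q0 q1 q2 q3 m :
  (forall x, 0 <= x -> 0 <= peval [q0; q1; q2; q3] x <= m) -> q1 = 0 /\ q2 = 0 /\ q3 = 0.
Proof.
  intros H.
  assert (H3 : q3 = 0).
  { assert (A : 0 <= q3) by (apply (leading_nonneg [q0; q1; q2]); intros x Hx; now apply H).
    assert (B : 0 <= - q3).
    { apply (leading_nonneg [m - q0; - q1; - q2]). intros x Hx. specialize (H x Hx).
      simpl in *. lra. }
    lra. }
  subst q3.
  assert (H2 : q2 = 0).
  { assert (A : 0 <= q2).
    { apply (leading_nonneg [q0; q1]); intros x Hx. specialize (H x Hx). simpl in *. lra. }
    assert (B : 0 <= - q2).
    { apply (leading_nonneg [m - q0; - q1]). intros x Hx. specialize (H x Hx).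
      simpl in *. lra. }
    lra. }
  subst q2.
  assert (H1 : q1 = 0).
  { assert (A : 0 <= q1).
    { apply (leading_nonneg [q0]); intros x Hx. specialize (H x Hx). simpl in *. lra. }
    assert (B : 0 <= - q1).
    { apply (leading_nonneg [m - q0]). intros x Hx. specialize (H x Hx).
      simpl in *. lra. }
    lra. }
  auto.
Qed.

(** The second zero is extracted from the quotient by (x-t)^2, so z = t is allowed and yields a
    quadruple zero. *)
Lemma sq_sq_factor f t z (F : R -> R) :
  0 <= t -> 0 <= z -> continuity F ->
  (forall x, 0 <= x -> 0 <= peval (phi f) x <= (x - t)^2 * ((x - z)^2 * F x)) ->
  exists m k,
    (forall x, peval (phi f) x = (x - t)^2 * ((x - z)^2 * (m + k * x))) /\
    (forall x, 0 <= x -> 0 <= m + k * x <= F x).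
Proof.
  intros Ht Hz HF H.
  destruct (sandwich_square (phi f) (fun x => (x - z)^2 * F x) t) as [p [Lp [Ep Bp]]]; trivial.
  { apply continuity_mult; [|exact HF]. simpl. poly_continuity. }
  destruct (sandwich_square p F z) as [q [Lq [Eq Bq]]]; trivial.
  rewrite Lp in Lq. simpl in Lq. length_list q Lq.
  exists r, r0. split.
  - intros x. rewrite Ep, Eq. simpl. ring.
  - intros x Hx. specialize (Bq x Hx). simpl in Bq. lra.
Qed.

(** * Families C, D, E and the isolated rays *)

Lemma eC_extremal t : 0 <= t <= 2 -> extremal (eC t).
Proof.
  intros Ht.
  assert (E : forall x, peval (phi (eC t)) x = (x - 1)^2 * ((x - t)^2 * x))
    by (intros; simpl; ring).
  apply extremal_intro.
  - apply inP_iff. split; intros x Hx.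
    + rewrite E. apply Rmult_le_pos; [apply pow2_ge_0|].
      apply Rmult_le_pos; [apply pow2_ge_0|exact Hx].
    (* [psi] is w^2 + (2-t) w: the bound t <= 2 enters here. *)
    + simpl. nra.
  - intros H. apply (f_equal c0) in H. simpl in H. lra.
  - intros g [Hg _].
    destruct (sq_sq_factor g 1 t (fun x => x)) as [m [k [Eg B]]]; try lra.
    { apply continuity_id. }
    { intros x Hx. rewrite <- E. auto. }
    exists k. apply phi_inj. intros x _. rewrite Eg, E.
    specialize (B 0 ltac:(lra)). replace m with 0 by lra. ring.
Qed.

Lemma eD_extremal t : 0 <= t -> extremal (eD t).
Proof.
  intros Ht.
  assert (E : forall x, peval (phi (eD t)) x = (x - 1)^2 * ((x - t)^2 * 2))
    by (intros; simpl; ring).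
  apply extremal_intro.
  - apply inP_iff. split; intros x Hx.
    + rewrite E. apply Rmult_le_pos; [apply pow2_ge_0|].
      apply Rmult_le_pos; [apply pow2_ge_0|lra].
    + simpl. nra.
  - intros H. apply (f_equal c1) in H. simpl in H. lra.
  - intros g [Hg _].
    destruct (sq_sq_factor g 1 t (fun x => 2)) as [m [k [Eg B]]]; try lra.
    { apply continuity_cst. }
    { intros x Hx. rewrite <- E. auto. }
    destruct (constant_of_bounded_cubic m k 0 0 2) as [K _].
    { intros x Hx. specialize (B x Hx). simpl. lra. }
    exists (m / 2). apply phi_inj. intros x _. rewrite Eg, E, K. field.
Qed.

Lemma eDinf_extremal : extremal eDinf.
Proof.
  assert (E : forall x, peval (phi eDinf) x = (x - 1)^2 * 2) by (intros; simpl; ring).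
  apply extremal_intro.
  - apply inP_iff. split; intros x Hx.
    + rewrite E. apply Rmult_le_pos; [apply pow2_ge_0|lra].
    + simpl. lra.
  - intros H. apply (f_equal c2) in H. simpl in H. lra.
  - intros g [Hg _].
    destruct (sandwich_square (phi g) (fun _ => 2) 1) as [q [L [Eg B]]];
      [lra|apply continuity_cst| |].
    { intros x Hx. rewrite <- E. auto. }
    simpl in L. length_list q L.
    destruct (constant_of_bounded_cubic _ _ _ _ _ B) as [-> [-> ->]].
    exists (r / 2). apply phi_inj. intros x _. rewrite Eg, E. simpl. field.
Qed.

Lemma psi_zero_coords g :
  (forall w, 0 <= w -> peval (psi g) w = 0) -> c0 g = 0 /\ c1 g = 0 /\ c2 g = 0.
Proof.
  intros H. assert (H0 := H 0). assert (H1 := H 1). assert (H2 := H 2).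
  simpl in *. lra.
Qed.

(** s4 vanishes on the face a = 0, so a summand combines s3 and s4 only; the quadratic growth of the
    bound x + 2x^2 excludes s3, whose [phi] is cubic. *)
Lemma eEinf_extremal : extremal eEinf.
Proof.
  apply extremal_intro.
  - apply inP_iff. split; intros x Hx; simpl; nra.
  - intros H. apply (f_equal c4) in H. simpl in H. lra.
  - intros g [Hg Hs].
    destruct (psi_zero_coords g) as [G0 [G1 G2]].
    { intros w Hw. specialize (Hs w Hw). simpl in Hs |- *. lra. }
    assert (G3 : c3 g = 0).
    { assert (0 <= c3 g).
      { apply (leading_nonneg [0; c3 g + c4 g; -2 * c3 g + 2 * c4 g]).
        intros x Hx. specialize (Hg x Hx). simpl in *. rewrite G0, G1, G2 in Hg. lra. }
      assert (0 <= - c3 g).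
      { apply (leading_nonneg [0; 1 - c3 g - c4 g; 2 + 2 * c3 g - 2 * c4 g]).
        intros x Hx. specialize (Hg x Hx). simpl in *. rewrite G0, G1, G2 in Hg. lra. }
      lra. }
    exists (c4 g). apply H35_eq; simpl; lra.
Qed.

Lemma eVI_extremal : extremal eVI.
Proof.
  assert (E : forall x, peval (phi eVI) x = (x - 1)^2 * x) by (intros; simpl; ring).
  apply extremal_intro.
  - apply inP_iff. split; intros x Hx.
    + rewrite E. apply Rmult_le_pos; [apply pow2_ge_0|lra].
    + simpl. lra.
  - intros H. apply (f_equal c3) in H. simpl in H. lra.
  - intros g [Hg Hs].
    destruct (psi_zero_coords g) as [G0 [G1 G2]].
    { intros w Hw. specialize (Hs w Hw). simpl in Hs |- *. lra. }
    specialize (Hg 1 ltac:(lra)). rewrite E in Hg. simpl in Hg.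
    exists (c3 g). apply H35_eq; simpl; lra.
Qed.

(** Comparison of coefficients. The last equation is the linear relation of [phi_coords] with a
    common factor 1 - t cancelled. *)
Lemma double_factor_coords f t q0 q1 q2 q3 :
  (forall x, peval (phi f) x = (x - t)^2 * peval [q0; q1; q2; q3] x) ->
  q3 = c0 f /\ q2 = 2 * c1 f + 2 * t * c0 f /\ t^2 * q0 = 2 * (c0 f + c1 f + c2 f) /\
  3 * c4 f = (1 - t)^2 * (q0 + q1 + q2 + q3) /\
  (t <> 1 ->
   2 * (t + 2) * q1 = (t - 7) * q2 + (4 * t - 10) * q3 - (5 * t + 1) * q0).
Proof.
  intros H.
  destruct (phi_coords f (t^2 * q0) (t^2 * q1 - 2 * t * q0) (t^2 * q2 - 2 * t * q1 + q0)
    (t^2 * q3 - 2 * t * q2 + q1) (q2 - 2 * t * q3) q3) as [H0 [H1 [H2 [H3 [H4 H5]]]]].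
  { intros x _. rewrite H. simpl. ring. }
  split; [lra|]. split; [rewrite H0; lra|]. split; [lra|]. split; [rewrite H4; field|]. intros Ht. apply Rmult_eq_reg_l with (1 - t); [lra|lra].
Qed.

(** The cofactor is the solution of the relation in [double_factor_coords] with q0 = q3 = 0 and q2 =
    2. For t >= 0 it is nonnegative on the half-line only when t >= 7. *)
Lemma eE_phi t x : t <> -2 ->
  peval (phi (eE t)) x = (x - t)^2 * (x * (2 * x + (t - 7) / (t + 2))).
Proof. intros Ht. simpl. field. lra. Qed.

(** The bound x(2x+k), read at 0 and at infinity, removes the constant and cubic terms of a
    summand's cofactor; the relation fixes the ratio of the other two. *)
Lemma eE_extremal t : 7 <= t -> extremal (eE t).
Proof.
  intros Ht.
  assert (E := fun x => eE_phi t x ltac:(lra)).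
  assert (Hk : 0 <= (t - 7) / (t + 2)).
  { apply Rmult_le_pos; [lra|]. apply Rlt_le, Rinv_0_lt_compat. lra. }
  set (k := (t - 7) / (t + 2)) in *.
  apply extremal_intro.
  - apply inP_iff. split; intros x Hx.
    + rewrite E. apply Rmult_le_pos; [apply pow2_ge_0|]. nra.
    + simpl. lra.
  - intros H. apply (f_equal c1) in H. simpl in H. lra.
  - intros g [Hg _].
    destruct (sandwich_square (phi g) (fun x => x * (2 * x + k)) t) as [q [L [Eg B]]]; [lra| | |].
    { poly_continuity. }
    { intros x Hx. rewrite <- E. auto. }
    simpl in L. length_list q L.
    destruct (double_factor_coords _ _ _ _ _ _ Eg) as [_ [_ [_ [_ Q]]]].
    specialize (Q ltac:(lra)).
    assert (r = 0) by (specialize (B 0 ltac:(lra)); simpl in B; lra).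
    assert (r2 = 0).
    { assert (0 <= r2) by (apply (leading_nonneg [r; r0; r1]); intros x Hx; now apply B).
      assert (0 <= - r2).
      { apply (leading_nonneg [- r; k - r0; 2 - r1]). intros x Hx. specialize (B x Hx).
        simpl in *. lra. }
      lra. }
    subst r r2.
    assert (r0 = r1 / 2 * k) by (unfold k; apply Rmult_eq_reg_l with (2 * (t + 2)); [rewrite Q; field|]; lra).
    exists (r1 / 2). apply phi_inj. intros x _. rewrite Eg, E. simpl. rewrite H. field.
Qed.

(** * Family A: two double zeros of [phi] *)

Definition kA (t z : R) : R := 7 - t - z - 5 * t * z.
(** For t and z different from 1, kA x + 2 mA is up to scale the only linear cofactor of (x-t)^2
    (x-z)^2 compatible with 5 p(1) = 3 p'(1); see [hA_unique]. *)
Definition mA (t z : R) : R := 2 * t + 2 * z + t * z - 5.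

(* The form whose [phi] is [(x-t)^2 (x-z)^2 (kA x + 2 mA)].  Family A is this one with
   [u = (t+2) kA t z]: then [u <= mu_L t] means [0 <= mA t z] and
   [u <= mu_H t] means [0 <= z]. *)
Definition hA (t z : R) : H35 :=
  let k := kA t z in let m := mA t z in let s := t + z in let p := t * z in
  mkH35 k (m - s * k) (p^2 * m - k - (m - s * k))
    ((s^2 + 2 * p) * k - 4 * s * m - 2 * p^2 * m + 2 * k + (2 * m - 2 * s * k))
    ((t - 1)^3 * (1 - z)^3).

Lemma hA_phi t z x :
  peval (phi (hA t z)) x = (x - t)^2 * ((x - z)^2 * (2 * mA t z + kA t z * x)).
Proof. unfold hA, kA, mA. simpl. ring. Qed.

Lemma kA_mA t z : kA t z + 2 * mA t z = 3 * (t - 1) * (1 - z).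
Proof. unfold kA, mA. ring. Qed.

Lemma hA_inP t z : 0 <= t -> 0 <= z -> 0 <= kA t z -> 0 <= mA t z -> inP (hA t z).
Proof.
  intros Ht Hz Hk Hm. apply inP_iff. split; intros x Hx.
  - rewrite hA_phi. apply Rmult_le_pos; [apply pow2_ge_0|].
    apply Rmult_le_pos; [apply pow2_ge_0|]. nra.
  - replace (peval (psi (hA t z)) x) with
      (kA t z * x^2 + ((3 - (t + z)) * kA t z + mA t z) * x + (t * z)^2 * mA t z)
      by (unfold hA; simpl; ring).
    assert (L : 0 <= (3 - (t + z)) * kA t z + mA t z).
    { destruct (Rle_lt_dec (t + z) 3) as [D|D]; [nra|].
      replace ((3 - (t + z)) * kA t z + mA t z)
        with ((t + z - 4)^2 + t * z * (5 * (t + z) - 14)) by (unfold kA, mA; ring).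
      apply Rplus_le_le_0_compat; [apply pow2_ge_0|].
      apply Rmult_le_pos; [apply Rmult_le_pos|]; lra. }
    assert (0 <= (t * z)^2 * mA t z) by (apply Rmult_le_pos; [apply pow2_ge_0|exact Hm]).
    assert (0 <= x^2) by apply pow2_ge_0. nra.
Qed.

(** The linear relation of [phi_coords], divided by (t-1)(z-1). *)
Lemma hA_unique f t z m k :
  t <> 1 -> z <> 1 ->
  (forall x, 0 <= x -> peval (phi f) x = (x - t)^2 * ((x - z)^2 * (m + k * x))) ->
  (m + k) * kA t z = k * (kA t z + 2 * mA t z).
Proof.
  intros Ht Hz E.
  destruct (phi_coords f (t^2 * z^2 * m)
    (t^2 * z^2 * k - 2 * t * z * (t + z) * m)
    (((t + z)^2 + 2 * t * z) * m - 2 * t * z * (t + z) * k)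
    (((t + z)^2 + 2 * t * z) * k - 2 * (t + z) * m)
    (m - 2 * (t + z) * k) k) as [_ [_ [_ [_ [_ H]]]]].
  { intros x Hx. rewrite E by exact Hx. simpl. ring. }
  rewrite kA_mA. unfold kA.
  assert (N : (t - 1) * (z - 1) <> 0) by (apply Rmult_integral_contrapositive; split; lra).
  apply Rmult_eq_reg_l with ((t - 1) * (z - 1)); [lra|exact N].
Qed.

Lemma hA_extremal t z :
  0 <= t -> 0 <= z -> 0 <= kA t z -> 0 <= mA t z -> t <> 1 -> z <> 1 -> extremal (hA t z).
Proof.
  intros Ht Hz Hk Hm Ht1 Hz1.
  assert (N : kA t z + 2 * mA t z <> 0).
  { rewrite kA_mA. apply Rmult_integral_contrapositive; split; lra. }
  apply extremal_intro.
  - now apply hA_inP.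
  - intros H. apply (f_equal c4) in H. simpl in H.
    revert H. apply Rmult_integral_contrapositive. split; apply (pow_nonzero _ 3); lra.
  - intros g [Hg _].
    destruct (sq_sq_factor g t z (fun x => 2 * mA t z + kA t z * x)) as [m [k [Eg _]]]; trivial.
    { poly_continuity. }
    { intros x Hx. rewrite <- hA_phi. auto. }
    assert (Q := hA_unique g t z m k Ht1 Hz1 (fun x _ => Eg x)).
    exists ((m + k) / (kA t z + 2 * mA t z)). apply phi_inj. intros x _.
    rewrite Eg, hA_phi.
    replace k with ((m + k) / (kA t z + 2 * mA t z) * kA t z) at 1
      by (unfold Rdiv; rewrite Rmult_assoc, (Rmult_comm (/ _)), <- Rmult_assoc, Q; now field).
    replace m with ((m + k) / (kA t z + 2 * mA t z) * (2 * mA t z)) at 1.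
    2: { apply Rmult_eq_reg_r with (kA t z + 2 * mA t z); [|exact N].
      replace ((m + k) / (kA t z + 2 * mA t z) * (2 * mA t z) * (kA t z + 2 * mA t z))
        with ((m + k) * (2 * mA t z)) by now field. lra. }
    ring.
Qed.

Lemma eA_hA t z :
  t <> -2 -> 5 * t + 1 <> 0 -> kA t z <> 0 ->
  eA t ((t + 2) * kA t z) = scaleH (/ kA t z) (hA t z).
Proof.
  intros H1 H2 H3. assert (H4 : t + 2 <> 0) by lra.
  (* Solving k = [kA t z] for z makes both sides rational functions of t and k, which [field] can
     compare. *)
  assert (E : forall k, k <> 0 ->
     eA t ((t + 2) * k) = scaleH (/ k) (hA t ((7 - t - k) / (5 * t + 1)))).
  { intros k Hk. unfold eA, hA, pA1, pA2, pA3, pA4, kA, mA.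
    apply H35_eq; simpl; field; auto. }
  rewrite (E _ H3).
  replace ((7 - t - kA t z) / (5 * t + 1)) with z by (unfold kA; field; trivial).
  reflexivity.
Qed.

(** u = 0 corresponds to [kA t z = 0], which determines z and makes the cofactor of the two squares
    constant. *)
Lemma eA0_hA t :
  5 * t + 1 <> 0 -> t <> 1 ->
  eA0 t = scaleH ((5 * t + 1)^3 / (9 * (t - 1)^2)) (hA t ((7 - t) / (5 * t + 1))).
Proof.
  intros H1 H2. unfold eA0, hA, kA, mA. apply H35_eq; simpl; field; split; lra.
Qed.

Lemma eA_extremal t u : 0 <= t <= 7 -> 0 < u <= mu_A t -> extremal (eA t u).
Proof.
  intros Ht [Hu Hu']. unfold mu_A in Hu'.
  assert (HL := Rmin_l (mu_L t) (mu_H t)). assert (HH := Rmin_r (mu_L t) (mu_H t)).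
  unfold mu_L, mu_H in *.
  set (k := u / (t + 2)). set (z := (7 - t - k) / (5 * t + 1)).
  assert (Ek : kA t z = k) by (unfold kA, z; field; lra).
  assert (Eu : u = (t + 2) * kA t z) by (rewrite Ek; unfold k; field; lra).
  assert (Hk : 0 < kA t z) by (apply Rmult_lt_reg_l with (t + 2); lra).
  assert (Hz : 0 <= z).
  { unfold z. apply Rmult_le_pos; [|apply Rlt_le, Rinv_0_lt_compat; lra].
    rewrite <- Ek. apply Rmult_le_reg_l with (t + 2); lra. }
  assert (Hm : 0 <= mA t z).
  { apply Rmult_le_reg_l with (2 * (5 * t + 1)); [lra|]. rewrite Rmult_0_r.
    apply Rmult_le_reg_l with (t + 2); [lra|]. rewrite Rmult_0_r.
    replace ((t + 2) * (2 * (5 * t + 1) * mA t z)) with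
      (2 * (t + 2) * (9 * (t - 1)^2 - (t + 2) * k))
      by (unfold mA, z; field; lra).
    rewrite <- Ek. apply Rmult_le_pos; lra. }
  (* The left side is the value of the cofactor at x = 1 and is positive, so neither t nor z is
     1. *)
  assert (N := kA_mA t z).
  assert (t <> 1) by (intros ->; lra). assert (z <> 1) by (intros E; rewrite E in N at 3; lra).
  rewrite Eu, eA_hA by lra. apply extremal_scale; [now apply Rinv_0_lt_compat|].
  apply hA_extremal; trivial; lra.
Qed.

Lemma eA0_extremal t : 0 <= t <= 7 -> extremal (eA0 t).
Proof.
  intros Ht. destruct (Req_dec t 1) as [->|Ht1].
  (* At t = 1 also z = 1, and [hA 1 1] is zero; the form is the one with a quadruple zero at 1. *)
  - replace (eA0 1) with (scaleH 36 (eD 1)) by (apply H35_eq; simpl; ring).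
    apply extremal_scale; [lra|]. apply eD_extremal; lra.
  - assert (D : 0 < 5 * t + 1) by lra.
    assert (Q : 0 < (t - 1)^2) by nra.
    rewrite eA0_hA by lra. apply extremal_scale.
    { apply Rdiv_lt_0_compat; [now apply pow_lt|lra]. }
    set (z := (7 - t) / (5 * t + 1)).
    assert (Ek : kA t z = 0) by (unfold kA, z; field; lra).
    assert (Em : mA t z = 9 * (t - 1)^2 / (5 * t + 1)) by (unfold mA, z; field; lra).
    assert (Hm : 0 < mA t z) by (rewrite Em; apply Rdiv_lt_0_compat; lra).
    assert (Hz : 0 <= z) by (apply Rmult_le_pos; [lra|apply Rlt_le, Rinv_0_lt_compat; lra]).
    assert (N := kA_mA t z).
    assert (z <> 1) by (intros E; rewrite E in N at 3; lra).
    apply hA_extremal; trivial; lra.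
Qed.

(** * Family B: a double zero t of [phi] and a double zero w of [psi] *)

Definition hB (t w : R) : H35 := mkH35 1 (pB1 t w) (pB2 t w) (pB3 t w) (pB4 t w).

(** The nontrivial factor of [c4 (hB t w)]. Its nonnegativity is the condition [mu_B t <= u] for w =
    [omega u]. *)
Definition slackB (t w : R) : R := t - 2 - (w / t)^2 - 2 * w.

Definition cofactorB (t w : R) : list R :=
  [2 * (w / t)^2; 1 - 4 * (w / t)^2 - (7 - t) / (t + 2) * slackB t w;
   2 * (w / t)^2 - 2 + 2 * slackB t w; 1].

Lemma cofactorB_eval t w x :
  peval (cofactorB t w) x
  = (x - 1)^2 * (x + 2 * (w / t)^2) + slackB t w * x * (2 * x - (7 - t) / (t + 2)).
Proof. unfold cofactorB. cbn [peval]. ring. Qed.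

Lemma hB_phi t w x : t <> 0 -> t <> -2 ->
  peval (phi (hB t w)) x = (x - t)^2 * peval (cofactorB t w) x.
Proof.
  intros H1 H2. unfold hB, cofactorB, slackB, pB1, pB2, pB3, pB4. simpl. field.
  split; [exact H1|lra].
Qed.

Lemma hB_psi t w x : peval (psi (hB t w)) x = (x - w)^2.
Proof. unfold hB, pB1, pB2. simpl. ring. Qed.

Lemma cofactorB_nonneg t w :
  2 <= t -> 0 <= w -> 0 <= slackB t w -> nonneg_ray (cofactorB t w).
Proof.
  intros Ht Hw Hs x Hx. rewrite cofactorB_eval.
  set (r := (7 - t) / (t + 2)). assert (Hy := pow2_ge_0 (w / t)).
  set (y := (w / t)^2) in *. assert (Hq := pow2_ge_0 (x - 1)).
  destruct (Rle_lt_dec r (2 * x)) as [D|D].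
  { assert (0 <= slackB t w * x * (2 * x - r)) by (apply Rmult_le_pos; [apply Rmult_le_pos|]; lra).
    nra. }
  assert (Hst : slackB t w <= t - 2) by (unfold slackB; fold y; lra).
  (* the worst case is [w = 0] *)
  assert (B : 0 <= (x - 1)^2 + (t - 2) * (2 * x - r)).
  { replace ((x - 1)^2 + (t - 2) * (2 * x - r)) with (x^2 + 2 * (t - 3) * x + (t - 4)^2 / (t + 2))
      by (unfold r; field; lra).
    assert (0 <= (t - 4)^2 / (t + 2))
      by (apply Rmult_le_pos; [apply pow2_ge_0|apply Rlt_le, Rinv_0_lt_compat; lra]).
    (* For t >= 3 all coefficients are nonnegative. For t < 3 the minimum lies at x = 3 - t, and
       with v = t - 2 its sign is that of v (3 - v - v^2). *)
    destruct (Rle_lt_dec 3 t); [nra|].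
    assert ((t - 3)^2 <= (t - 4)^2 / (t + 2)).
    { apply Rmult_le_reg_r with (t + 2); [lra|].
      replace ((t - 4)^2 / (t + 2) * (t + 2)) with ((t - 4)^2) by (field; lra).
      assert (0 <= (t - 2) * (3 - (t - 2) - (t - 2)^2)) by (apply Rmult_le_pos; nra). lra. }
    assert (0 <= (x + (t - 3))^2) by apply pow2_ge_0. nra. }
  assert (slackB t w * x * (r - 2 * x) <= (t - 2) * x * (r - 2 * x)).
  { apply Rmult_le_compat_r; [lra|]. apply Rmult_le_compat_r; lra. }
  assert (0 <= x * ((x - 1)^2 + (t - 2) * (2 * x - r))) by now apply Rmult_le_pos.
  assert (0 <= (x - 1)^2 * (2 * y)) by (apply Rmult_le_pos; lra). lra.
Qed.

(** The zero of [psi f] determines c1 and c2 from c0, hence all of q except its linear coefficient,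
    which the relation in [double_factor_coords] supplies. *)
Lemma hB_unique f t w q :
  0 < t -> t <> 1 -> length q = 4%nat ->
  (forall x, peval (phi f) x = (x - t)^2 * peval q x) ->
  (forall x, 0 <= x -> peval (psi f) x = c0 f * (x - w)^2) ->
  f = scaleH (c0 f) (hB t w).
Proof.
  intros Ht Ht1 L E S. length_list q L.
  destruct (double_factor_coords _ _ _ _ _ _ E) as [Q3 [Q2 [Q0 [_ Q1]]]].
  specialize (Q1 Ht1).
  assert (S0 := S 0). assert (S1 := S 1). simpl in S0, S1.
  assert (P : c0 f + c1 f + c2 f = c0 f * w^2) by lra.
  assert (P1 : c1 f = - (2 * w + 3) * c0 f) by lra.
  assert (R3 : r2 = c0 f) by exact Q3.
  assert (R2 : r1 = c0 f * (2 * (w / t)^2 - 2 + 2 * slackB t w)).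
  { rewrite Q2, P1. unfold slackB. ring. }
  assert (R0 : r = c0 f * (2 * (w / t)^2)).
  { apply Rmult_eq_reg_l with (t^2); [|apply pow_nonzero; lra].
    rewrite Q0, P. field. lra. }
  assert (R1 : r0 = c0 f * (1 - 4 * (w / t)^2 - (7 - t) / (t + 2) * slackB t w)).
  { apply Rmult_eq_reg_l with (2 * (t + 2)); [|lra].
    rewrite Q1, R0, R2, R3. unfold slackB. field. lra. }
  apply phi_inj. intros x _. rewrite E, hB_phi by lra.
  rewrite R0, R1, R2, R3. unfold cofactorB. cbn [peval]. ring.
Qed.

Lemma hB_extremal t w : 2 <= t -> 0 <= w -> 0 <= slackB t w -> extremal (hB t w).
Proof.
  intros Ht Hw Hs. assert (N := cofactorB_nonneg t w Ht Hw Hs).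
  assert (E := fun x => hB_phi t w x ltac:(lra) ltac:(lra)).
  apply extremal_intro.
  - apply inP_iff. split; intros x Hx.
    + rewrite E. apply Rmult_le_pos; [apply pow2_ge_0|now apply N].
    + rewrite hB_psi. apply pow2_ge_0.
  - intros H. apply (f_equal c0) in H. simpl in H. lra.
  - intros g [Hg Hs'].
    destruct (sandwich_square (phi g) (peval (cofactorB t w)) t) as [q [L [Eg _]]];
      [lra|apply peval_continuity|intros x Hx; rewrite <- E; auto|].
    destruct (sandwich_square (psi g) (fun _ => 1) w) as [p [Lp [Ep _]]];
      [lra|apply continuity_cst|intros x Hx; specialize (Hs' x Hx); rewrite hB_psi in Hs'; lra|].
    simpl in Lp. length_list p Lp.
    assert (r = c0 g).
    { assert (A0 := Ep 0). assert (A1 := Ep 1). assert (A2 := Ep 2). simpl in A0, A1, A2. lra. }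
    exists (c0 g). apply (hB_unique g t w q); trivial; try lra.
    intros x _. rewrite Ep, <- H. simpl. ring.
Qed.

(** t^2 [slackB t w] is the difference of the squares of t sqrt((t-1)(t+2)) and w + t^2. *)
Lemma slackB_mu_R t w :
  2 <= t -> 0 <= w -> (0 <= slackB t w <-> w + 2 <= mu_R t).
Proof.
  intros Ht Hw. unfold mu_R. set (s := sqrt ((t - 1) * (t + 2))).
  assert (H0 : 0 <= s) by apply sqrt_pos.
  assert (H1 : s * s = (t - 1) * (t + 2)) by (apply sqrt_sqrt; nra).
  assert (E : t^2 * slackB t w = (t * s)^2 - (w + t^2)^2).
  { replace ((t * s)^2) with (t^2 * (s * s)) by ring. rewrite H1. unfold slackB. field. lra. }
  assert (0 < t^2) by nra. assert (0 <= t * s) by nra.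
  split; intros H'.
  - enough (w + t^2 <= t * s) by lra.
    destruct (Rle_lt_dec (w + t^2) (t * s)); [assumption|exfalso]. nra.
  - apply Rmult_le_reg_l with (t^2); [assumption|]. nra.
Qed.

(** After multiplication by u this is u^2 - r u + 1 <= 0. The roots are reciprocal, so for u <= 1
    only the smaller one matters. *)
Lemma omega_le_iff r u :
  2 <= r -> 0 < u <= 1 -> (u + / u <= r <-> / 2 * (r - sqrt (r^2 - 4)) <= u).
Proof.
  intros Hr Hu. assert (D : 0 <= r^2 - 4) by nra.
  set (s := sqrt (r^2 - 4)). assert (H0 : 0 <= s) by apply sqrt_pos.
  assert (H1 : s * s = r^2 - 4) by (now apply sqrt_sqrt).
  assert (E : u * (r - (u + / u)) = (u - / 2 * (r - s)) * (/ 2 * (r + s) - u)).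
  { replace ((u - / 2 * (r - s)) * (/ 2 * (r + s) - u))
      with (u * r - u^2 - / 4 * (r^2 - s * s)) by field. rewrite H1. field. lra. }
  assert (1 <= / 2 * (r + s)) by lra.
  split; intros H'.
  - assert (F : 0 <= (u - / 2 * (r - s)) * (/ 2 * (r + s) - u))
      by (rewrite <- E; apply Rmult_le_pos; lra).
    destruct (Rle_lt_dec (/ 2 * (r - s)) u); [assumption|exfalso].
    destruct (Req_dec u (/ 2 * (r + s))) as [Q|Q]; [lra|]. nra.
  - assert (F : 0 <= (u - / 2 * (r - s)) * (/ 2 * (r + s) - u)) by (apply Rmult_le_pos; lra).
    rewrite <- E in F. enough (0 <= r - (u + / u)) by lra.
    apply Rmult_le_reg_l with u; lra.
Qed.

Lemma omega_nonneg u : 0 < u -> 0 <= omega u.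
Proof.
  intros Hu. unfold omega. replace (u + / u - 2) with ((u - 1)^2 * / u) by (field; lra).
  apply Rmult_le_pos; [apply pow2_ge_0|apply Rlt_le, Rinv_0_lt_compat, Hu].
Qed.

Lemma mu_R_ge t : 2 <= t -> 2 <= mu_R t.
Proof.
  intros Ht. assert (H := slackB_mu_R t 0 Ht (Rle_refl 0)).
  enough (0 <= slackB t 0) by (apply H in H0; lra).
  unfold slackB. replace (0 / t) with 0 by (field; lra). lra.
Qed.

Lemma mu_B_pos t : 2 <= t -> 0 < mu_B t.
Proof.
  intros Ht. assert (H := mu_R_ge t Ht). unfold mu_B. set (r := mu_R t) in *.
  assert (D : 0 <= r^2 - 4) by nra.
  set (s := sqrt (r^2 - 4)). assert (H0 : 0 <= s) by apply sqrt_pos.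
  assert (H1 : s * s = r^2 - 4) by (now apply sqrt_sqrt).
  assert (s < r) by nra. lra.
Qed.

Lemma mu_B_le_iff t u :
  2 <= t -> 0 < u <= 1 -> (mu_B t <= u <-> 0 <= slackB t (omega u)).
Proof.
  intros Ht Hu. rewrite slackB_mu_R; [|exact Ht|apply omega_nonneg; lra].
  unfold mu_B. rewrite <- omega_le_iff by (trivial; now apply mu_R_ge).
  unfold omega. lra.
Qed.

Lemma eB_extremal t u : 2 <= t -> mu_B t <= u <= 1 -> extremal (eB t u).
Proof.
  intros Ht Hu. assert (H := mu_B_pos t Ht).
  change (eB t u) with (hB t (omega u)). apply hB_extremal; trivial.
  - apply omega_nonneg. lra.
  - apply mu_B_le_iff; trivial; lra.
Qed.

Lemma omega_surj w : 0 <= w -> exists u, 0 < u <= 1 /\ omega u = w.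
Proof.
  intros Hw. set (s := sqrt (w^2 + 4 * w)).
  assert (H0 : 0 <= s) by apply sqrt_pos.
  assert (H1 : s * s = w^2 + 4 * w) by (apply sqrt_sqrt; nra).
  set (u := (w + 2 - s) / 2).
  assert (Hu : 0 < u <= 1) by (unfold u; split; nra).
  exists u. split; [exact Hu|]. unfold omega.
  replace (/ u) with ((w + 2 + s) / 2); [unfold u; field|].
  apply Rmult_eq_reg_l with u; [|lra]. rewrite Rinv_r by lra. unfold u. nra.
Qed.

Lemma listed_extremal f : listed f -> extremal f.
Proof.
  intros [[t [u [Ht [Hu ->]]]]|[[t [Ht ->]]|[[t [u [Ht [Hu ->]]]]|[[t [Ht ->]]
    |[[t [Ht ->]]|[->|[[t [Ht ->]]|[->| ->]]]]]]]].
  - now apply eA_extremal.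
  - now apply eA0_extremal.
  - now apply eB_extremal.
  - now apply eC_extremal.
  - now apply eD_extremal.
  - apply eDinf_extremal.
  - now apply eE_extremal.
  - apply eEinf_extremal.
  - apply eVI_extremal.
Qed.

(** * Classification *)

Definition on_listed_ray (f : H35) : Prop :=
  exists g, listed g /\ exists l, 0 < l /\ f = scaleH l g.

(** A zero at a positive point is automatically double, whereas one at 0 may be simple; the second
    alternative therefore tolerates a simple zero at 0. *)
Lemma double_zero_or_positive p :
  nonneg_ray p ->
  (exists t q, 0 <= t /\ length q = pred (pred (length p)) /\
     (forall x, peval p x = (x - t)^2 * peval q x) /\ nonneg_ray q) \/
  ((forall x, 0 < x -> 0 < peval p x) /\ (nth 0 p 0 <> 0 \/ nth 1 p 0 <> 0)).
Proof.
  intros H. destruct (classic (exists t, 0 < t /\ peval p t = 0)) as [[t [Ht Z]]|N].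
  { left. destruct (positive_zero_factor p t Ht H Z) as [q [L [E Q]]].
    exists t, q. repeat split; trivial; lra. }
  destruct (classic (nth 0 p 0 <> 0 \/ nth 1 p 0 <> 0)) as [D|D].
  - right. split; [|exact D]. intros x Hx.
    destruct (H x ltac:(lra)) as [?|Z]; [assumption|].
    exfalso; apply N; now exists x.
  - left. assert (nth 0 p 0 = 0) by tauto. assert (nth 1 p 0 = 0) by tauto.
    assert (E : exists q, length q = pred (pred (length p)) /\
              forall x, peval p x = (x - 0)^2 * peval q x).
    { destruct p as [|a [|b q]]; simpl in *; subst.
      - exists []; split; [reflexivity|]; intros; simpl; ring.
      - exists []; split; [reflexivity|]; intros; simpl; ring.
      - exists q; split; [reflexivity|]; intros; ring. }
    destruct E as [q [L E]]. exists 0, q. repeat split; trivial; [lra|].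
    assert (K : forall x, 0 <= x -> x <> 0 -> 0 <= peval q x).
    { intros x Hx Hx0. specialize (H x Hx). rewrite E in H.
      apply Rmult_le_reg_l with ((x - 0)^2); [nra|lra]. }
    intros x Hx. destruct (Req_dec x 0) as [->|]; [|now apply K].
    apply continuous_nonneg_at; trivial. apply peval_continuity.
Qed.

(** f is the midpoint of f + e g and f - e g. The direction g need not lie in the cone. *)
Lemma extremal_perturb f g e :
  extremal f -> 0 < e ->
  (forall x, 0 <= x -> Rabs (e * peval (phi g) x) <= peval (phi f) x) ->
  (forall w, 0 <= w -> Rabs (e * peval (psi g) w) <= peval (psi f) w) ->
  exists l, g = scaleH l f.
Proof.
  intros [_ [_ K]] He Hp Hs.
  assert (B : forall d, d = e \/ d = - e -> inP (scaleH (1/2) (addH f (scaleH d g)))).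
  { intros d Hd. apply inP_iff. split; intros x Hx.
    - specialize (Hp x Hx).
      rewrite phi_scale, phi_add, phi_scale.
      assert (H1 := Rle_abs (e * peval (phi g) x)).
      assert (H2 := Rle_abs (- (e * peval (phi g) x))). rewrite Rabs_Ropp in H2.
      destruct Hd; subst d; lra.
    - specialize (Hs x Hx).
      rewrite psi_scale, psi_add, psi_scale.
      assert (H1 := Rle_abs (e * peval (psi g) x)).
      assert (H2 := Rle_abs (- (e * peval (psi g) x))). rewrite Rabs_Ropp in H2.
      destruct Hd; subst d; lra. }
  destruct (K _ _ (B e ltac:(auto)) (B (- e) ltac:(auto))) as [[l [_ E]] _].
  { apply H35_eq; simpl; field. }
  exists ((2 * l - 1) / e).
  assert (S : forall u v, 1 / 2 * (u + e * v) = l * u -> v = (2 * l - 1) / e * u).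
  { intros u v Huv. apply Rmult_eq_reg_l with e; [|lra].
    replace (e * ((2 * l - 1) / e * u)) with (2 * l * u - u) by (field; lra). lra. }
  unfold scaleH, addH in E. simpl in E. injection E as E0 E1 E2 E3 E4.
  apply H35_eq; simpl; now apply S.
Qed.

Lemma extremal_above f g e :
  extremal f -> inP g -> g <> zeroH -> 0 < e ->
  (forall x, 0 <= x -> e * peval (phi g) x <= peval (phi f) x) ->
  (forall w, 0 <= w -> e * peval (psi g) w <= peval (psi f) w) ->
  exists l, 0 < l /\ f = scaleH l g.
Proof.
  intros Hf Hg G0 He Hp Hs. assert (Hg' := Hg). apply inP_iff in Hg' as [Gp Gs].
  destruct (extremal_perturb f g e) as [l El]; trivial.
  { intros x Hx. rewrite Rabs_right; auto. apply Rle_ge, Rmult_le_pos; [lra|auto]. }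
  { intros x Hx. rewrite Rabs_right; auto. apply Rle_ge, Rmult_le_pos; [lra|auto]. }
  destruct Hf as [Hf [F0 _]].
  assert (0 <= l) by (apply inP_pointed with f; trivial; now rewrite <- El).
  assert (l <> 0).
  { intros ->. apply G0. rewrite El. apply H35_eq; simpl; ring. }
  exists (/ l). split; [apply Rinv_0_lt_compat; lra|].
  rewrite El, scale_scale, Rinv_l, scale_one by assumption. reflexivity.
Qed.

Lemma listed_ray f : listed f -> on_listed_ray f.
Proof. intros H. exists f. split; [exact H|]. exists 1. split; [lra|]. now rewrite scale_one. Qed.

Lemma extremal_above_listed f g e :
  extremal f -> listed g -> 0 < e ->
  (forall x, 0 <= x -> e * peval (phi g) x <= peval (phi f) x) ->
  (forall w, 0 <= w -> e * peval (psi g) w <= peval (psi f) w) ->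
  on_listed_ray f.
Proof.
  intros Hf Hg He Hp Hs. exists g. split; [exact Hg|].
  destruct (listed_extremal g Hg) as [G [G0 _]].
  now apply extremal_above with e.
Qed.

Lemma scaled_on_listed_ray k f : 0 < k -> on_listed_ray f -> on_listed_ray (scaleH k f).
Proof.
  intros Hk [g [Hg [l [Hl ->]]]]. exists g. split; [exact Hg|].
  exists (k * l). split; [now apply Rmult_lt_0_compat|apply scale_scale].
Qed.

Lemma hA_listed t z :
  0 <= t -> 0 <= z -> 0 <= kA t z -> 0 <= mA t z -> t <> 1 -> on_listed_ray (hA t z).
Proof.
  intros Ht Hz Hk Hm Ht1.
  assert (Ht7 : t <= 7).
  { unfold kA in Hk. assert (0 <= t * z) by (apply Rmult_le_pos; lra). lra. }
  destruct (Req_dec (kA t z) 0) as [K0|K0].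
  - assert (Ez : z = (7 - t) / (5 * t + 1)).
    { apply Rmult_eq_reg_l with (5 * t + 1); [|lra]. field_simplify; [|lra].
      unfold kA in K0. lra. }
    assert (0 < (t - 1)^2) by nra.
    set (c := (5 * t + 1)^3 / (9 * (t - 1)^2)).
    assert (Hc : 0 < c).
    { apply Rdiv_lt_0_compat; [apply pow_lt|]; lra. }
    replace (hA t z) with (scaleH (/ c) (eA0 t)).
    + apply scaled_on_listed_ray; [now apply Rinv_0_lt_compat|].
      apply listed_ray. right; left. exists t. split; [lra|reflexivity].
    + rewrite eA0_hA, <- Ez by lra. fold c.
      rewrite scale_scale, Rinv_l, scale_one by lra. reflexivity.
  - replace (hA t z) with (scaleH (kA t z) (eA t ((t + 2) * kA t z)))
      by (rewrite eA_hA, scale_scale, Rinv_r, scale_one by lra; reflexivity).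
    apply scaled_on_listed_ray; [lra|]. apply listed_ray. left.
    exists t, ((t + 2) * kA t z). split; [lra|]. split; [|reflexivity].
    split; [apply Rmult_lt_0_compat; lra|]. apply Rmin_glb.
    + unfold mu_L. enough (0 <= (5 * t + 1) * mA t z) by (unfold kA, mA in *; lra).
      apply Rmult_le_pos; lra.
    + unfold mu_H, kA. assert (0 <= z * (1 + 5 * t)) by (apply Rmult_le_pos; lra).
      apply Rmult_le_compat_l; lra.
Qed.

Lemma hB_listed t w : 2 <= t -> 0 <= w -> 0 <= slackB t w -> on_listed_ray (hB t w).
Proof.
  intros Ht Hw Hs. destruct (omega_surj w Hw) as [u [Hu <-]].
  apply listed_ray. right; right; left. exists t, u.
  split; [exact Ht|]. split; [|reflexivity]. split; [|lra].
  apply mu_B_le_iff; trivial.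
Qed.

Lemma c4_hB t w : t <> 0 -> t + 2 <> 0 -> c4 (hB t w) = (t - 1)^3 * slackB t w / (t + 2).
Proof. intros. unfold hB, pB4, slackB. simpl. field. auto. Qed.

Lemma classify_two_double_zeros f t z m k :
  0 <= t -> 0 <= z -> c4 f <> 0 -> nonneg_ray [m; k] ->
  (forall x, peval (phi f) x = (x - t)^2 * ((x - z)^2 * (m + k * x))) ->
  on_listed_ray f.
Proof.
  intros Ht Hz C Hmk E.
  assert (Hm : 0 <= m) by (specialize (Hmk 0 ltac:(lra)); simpl in Hmk; lra).
  assert (Hk : 0 <= k) by (now apply (leading_nonneg [m])).
  assert (E1 : 3 * c4 f = (1 - t)^2 * ((1 - z)^2 * (m + k))).
  { specialize (E 1). rewrite Rmult_1_r in E. rewrite <- E. simpl. ring. }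
  assert (Ht1 : t <> 1) by (intros ->; apply C; lra).
  assert (Hz1 : z <> 1) by (intros ->; apply C; lra).
  assert (Hs : m + k <> 0) by (intros Z; apply C; rewrite Z in E1; lra).
  assert (Q := hA_unique f t z m k Ht1 Hz1 (fun x _ => E x)).
  assert (Q' : (m + k) * (2 * mA t z) = m * (kA t z + 2 * mA t z)) by lra.
  assert (N := kA_mA t z). set (n := kA t z + 2 * mA t z) in *.
  assert (Hn : n <> 0).
  { rewrite N. apply Rmult_integral_contrapositive; split; lra. }
  (* If n < 0, then t and z lie on the same side of 1: both below gives kA > 0 against [Q], both
     above gives mA > 0 against [Q']. *)
  assert (Hn' : 0 < n).
  { destruct (Rle_lt_dec n 0) as [L|]; [exfalso|assumption].
    destruct (Rle_lt_dec t 1) as [Lt|Lt].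
    - assert (z < 1) by nra.
      assert (0 < kA t z) by (unfold kA; nra). nra.
    - assert (1 < z) by nra.
      assert (0 < mA t z) by (unfold mA; nra). nra. }
  assert (0 <= kA t z) by (apply Rmult_le_reg_l with (m + k); nra).
  assert (0 <= mA t z) by (apply Rmult_le_reg_l with (2 * (m + k)); nra).
  replace f with (scaleH ((m + k) / n) (hA t z)).
  - apply scaled_on_listed_ray; [apply Rdiv_lt_0_compat; lra|].
    now apply hA_listed.
  - symmetry. apply phi_inj. intros x _. rewrite E, hA_phi.
    replace k with ((m + k) / n * kA t z) at 1
      by (unfold Rdiv; rewrite Rmult_assoc, (Rmult_comm (/ _)), <- Rmult_assoc, Q; now field).
    replace m with ((m + k) / n * (2 * mA t z)) at 1
      by (unfold Rdiv; rewrite Rmult_assoc, (Rmult_comm (/ _)), <- Rmult_assoc, Q'; now field).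
    ring.
Qed.

Lemma classify_c4_zero f : extremal f -> c4 f = 0 -> on_listed_ray f.
Proof.
  intros Hf C. assert (HP := Hf). destruct HP as [HP [F0 _]].
  apply inP_iff in HP as [Hp Hs].
  destruct (positive_zero_factor (phi f) 1) as [q [L [E Q]]];
    [lra|exact Hp|simpl; rewrite C; ring|].
  simpl in L. length_list q L.
  destruct (double_zero_or_positive _ Q) as [[t [q [Ht [L [Eq Qq]]]]]|[Pos Low]].
  - simpl in L. length_list q L. rename r3 into m, r4 into k.
    assert (Hm : 0 <= m) by (specialize (Qq 0 ltac:(lra)); simpl in Qq; lra).
    assert (Hk : 0 <= k) by (now apply (leading_nonneg [m])).
    assert (Ef : f = addH (scaleH k (eC t)) (scaleH (m / 2) (eD t))).
    { rewrite <- (scale_one (addH _ _)). apply phi_inj. intros x _.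
      rewrite E, Eq. simpl. field. }
    assert (Ep : forall x, peval (phi f) x
       = (x - 1)^2 * ((x - t)^2 * (m + k * x))) by (intros; rewrite E, Eq; simpl; ring).
    assert (Es : forall w, peval (psi f) w = k * (w^2 + (2 - t) * w) + m / 2 * (w + t^2))
      by (intros; rewrite Ef; simpl; field).
    assert (Hmk : m = 0 -> k = 0 -> False).
    { intros -> ->. apply F0. rewrite Ef. apply H35_eq; simpl; field. }
    assert (LD : listed (eD t)) by (do 4 right; left; now exists t).
    assert (DP : inP (eD t)) by apply (listed_extremal _ LD).
    apply inP_iff in DP as [Dp Ds].
    destruct (Req_dec k 0) as [K0|K0].
    { exists (eD t). split; [exact LD|]. exists (m / 2).
      split; [destruct (Req_dec m 0); [tauto|lra]|].
      rewrite Ef, K0. apply H35_eq; simpl; ring. }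
    (* For t <= 2 the summand in [eC t] can be split off. Beyond 2 that form is negative for 0 < w <
       t - 2 on the face a = 0, and m > 0 has to compensate. *)
    destruct (Rle_lt_dec t 2) as [T|T].
    { apply extremal_above_listed with (eC t) k; trivial; [|lra| |].
      - do 3 right; left. exists t. split; [lra|reflexivity].
      - intros x Hx. rewrite Ef, phi_add, !phi_scale.
        assert (0 <= m / 2 * peval (phi (eD t)) x) by (apply Rmult_le_pos; [lra|auto]). lra.
      - intros x Hx. rewrite Ef, psi_add, !psi_scale.
        assert (0 <= m / 2 * peval (psi (eD t)) x) by (apply Rmult_le_pos; [lra|auto]). lra. }
    assert (Hm0 : m <> 0).
    { intros M0. specialize (Hs ((t - 2) / 2) ltac:(lra)). rewrite Es, M0 in Hs.
      assert (0 < k * (t - 2)^2) by (apply Rmult_lt_0_compat; nra). lra. }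
    destruct (double_zero_or_positive _ Hs) as [[w [p [Hw [L [Ew _]]]]]|[Pos _]].
    + simpl in L. length_list p L.
      assert (EB : f = scaleH (c0 f) (hB t w)).
      { apply (hB_unique f t w [m; k - 2 * m; m - 2 * k; k]); trivial; try lra.
        - intros x. rewrite Ep. simpl. ring.
        - intros x _. rewrite Ew.
          assert (A0 := Ew 0). assert (A1 := Ew 1). assert (A2 := Ew 2). simpl in A0, A1, A2.
          replace (c0 f) with r3 by lra. simpl. ring. }
      assert (Ek : c0 f = k) by (rewrite Ef; simpl; ring).
      rewrite Ek in EB.
      (* [c4 f = 0] puts f at the end u = [mu_B t] of family B. *)
      assert (S0 : slackB t w = 0).
      { rewrite EB in C. change (k * c4 (hB t w) = 0) in C. rewrite c4_hB in C by lra.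
        apply Rmult_integral in C as [C|C]; [lra|].
        assert (C' : (t - 1)^3 * slackB t w = 0).
        { apply Rmult_eq_reg_r with (/ (t + 2)); [|apply Rinv_neq_0_compat; lra].
          unfold Rdiv in C. lra. }
        apply Rmult_integral in C' as [C'|C']; [|exact C'].
        exfalso. revert C'. apply pow_nonzero. lra. }
      rewrite EB. apply scaled_on_listed_ray; [lra|].
      apply hB_listed; lra.
    + (* [w * psi] has a simple zero at 0, so the lower bound for it gives [psi >= e (1 + w)] *)
      destruct (ray_lower_bound 2 (0 :: psi f)) as [e [He B]].
      { lia. }
      { intros x Hx. specialize (Pos x Hx). simpl in *. nra. }
      { right. specialize (Es 0). simpl in Es |- *.
        assert (0 < m * t^2) by (apply Rmult_lt_0_compat; nra). lra. }
      { exists 3%nat. split; [simpl; lia|]. rewrite Ef. simpl. lra. }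
      assert (B' : forall w, 0 <= w -> e * (1 + w) <= peval (psi f) w).
      { assert (B0 : forall w, 0 <= w -> w <> 0 -> 0 <= peval (psi f) w - e * (1 + w)).
        { intros w Hw W0. specialize (B w Hw).
          change (peval (0 :: psi f) w) with (0 + w * peval (psi f) w) in B.
          apply Rmult_le_reg_l with w; [lra|]. lra. }
        intros w Hw. enough (0 <= peval (psi f) w - e * (1 + w)) by lra.
        destruct (Req_dec w 0) as [->|W0]; [|auto].
        apply (continuous_nonneg_at (fun w => peval (psi f) w - e * (1 + w))); [|lra|auto].
        apply continuity_minus; [apply peval_continuity|poly_continuity]. }
      (* The first bound serves [phi]; the second serves [psi], through w + t^2 <= (1 + t^2)(1 +
         w). *)
      set (d := Rmin (m / 2) (e / (1 + t^2))).
      assert (T2 : 0 <= t^2) by apply pow2_ge_0.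
      assert (D0 : 0 < d).
      { apply Rmin_pos; [lra|]. apply Rdiv_lt_0_compat; lra. }
      assert (D1 : d <= m / 2) by apply Rmin_l.
      assert (D2 : d * (1 + t^2) <= e).
      { apply Rle_trans with (e / (1 + t^2) * (1 + t^2)); [|right; field; lra].
        apply Rmult_le_compat_r; [lra|apply Rmin_r]. }
      apply extremal_above_listed with (eD t) d; trivial.
      * intros x Hx. rewrite Ef, phi_add, !phi_scale.
        assert (0 <= (m / 2 - d) * peval (phi (eD t)) x) by (apply Rmult_le_pos; [lra|auto]).
        enough (0 <= k * peval (phi (eC t)) x) by lra.
        replace (peval (phi (eC t)) x) with ((x - 1)^2 * (x - t)^2 * x) by (simpl; ring).
        apply Rmult_le_pos; [exact Hk|]. apply Rmult_le_pos; [|exact Hx].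
        apply Rmult_le_pos; apply pow2_ge_0.
      * intros w Hw. specialize (B' w Hw).
        replace (peval (psi (eD t)) w) with (w + t^2) by (simpl; ring).
        enough (d * (w + t^2) <= d * (1 + t^2) * (1 + w)) by nra.
        rewrite Rmult_assoc. apply Rmult_le_compat_l; nra.
  (* A non-constant cofactor dominates a multiple of x, which leaves room for s3; a constant one is
     the form [eDinf]. *)
  - destruct (classic (r0 <> 0 \/ r1 <> 0 \/ r2 <> 0)) as [D|D].
    + destruct (ray_lower_bound 1 [r; r0; r1; r2]) as [e [He B]]; trivial.
      { destruct D as [D|[D|D]]; [exists 1%nat|exists 2%nat|exists 3%nat];
          (split; [simpl; lia|exact D]). }
      apply extremal_above_listed with eVI e; trivial.
      * do 8 right. reflexivity.
      * intros x Hx. replace (peval (phi eVI) x) with ((x - 1)^2 * x) by (simpl; ring).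
        rewrite E. specialize (B x Hx). rewrite pow_1 in B.
        assert (0 <= (x - 1)^2) by apply pow2_ge_0.
        assert (0 <= e * x) by (apply Rmult_le_pos; lra). nra.
      * intros w Hw. specialize (Hs w Hw). simpl in *. lra.
    + exists eDinf. split; [do 5 right; left; reflexivity|].
      exists (r / 2). split.
      * specialize (Pos 1 ltac:(lra)). simpl in Pos. lra.
      * apply phi_inj. intros x _. rewrite E.
        assert (r0 = 0) by tauto. assert (r1 = 0) by tauto. assert (r2 = 0) by tauto.
        subst. simpl. field.
Qed.

(** Excludes 0 < t < 1 by the test points 4 and 3: if the value at 4 is positive, then w/t is at
    most t/2, and the value at 3 is not positive. *)
Lemma cofactorB_negative t w :
  0 < t < 1 -> 0 <= w -> exists x, 1 < x /\ peval (cofactorB t w) x <= 0.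
Proof.
  intros Ht Hw. set (r := w / t).
  assert (Hr : 0 <= r) by (apply Rmult_le_pos; [lra|apply Rlt_le, Rinv_0_lt_compat; lra]).
  assert (Ew : w = t * r) by (unfold r; field; lra).
  assert (E4 : (t + 2) * peval (cofactorB t w) 4 = - 18 * t * (r^2 + 4 * r * (t + 1) - 2 * t)).
  { unfold cofactorB, slackB. fold r. rewrite Ew. cbn [peval]. field. lra. }
  assert (E3 : (t + 2) * peval (cofactorB t w) 3
     = 3 * (7 * t + 2) * (t - 1) - r * (42 * t^2 + 30 * t) + r^2 * (1 - 13 * t)).
  { unfold cofactorB, slackB. fold r. rewrite Ew. cbn [peval]. field. lra. }
  destruct (Rle_lt_dec 0 (r^2 + 4 * r * (t + 1) - 2 * t)) as [D|D].
  - exists 4. split; [lra|]. apply Rmult_le_reg_l with (t + 2); [lra|].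
    rewrite E4, Rmult_0_r. nra.
  - exists 3. split; [lra|]. apply Rmult_le_reg_l with (t + 2); [lra|].
    rewrite E3, Rmult_0_r.
    assert (R2 : 2 * r <= t) by nra.
    assert (0 <= r^2) by apply pow2_ge_0. nra.
Qed.

Lemma eE_sign t : 0 <= t < 7 -> exists x, 0 < x /\ peval (phi (eE t)) x < 0.
Proof.
  intros Ht. set (k := (7 - t) / (t + 2)).
  assert (Hk : 0 < k) by (apply Rdiv_lt_0_compat; lra).
  assert (K : forall x, 0 < x < k / 2 -> x <> t -> peval (phi (eE t)) x < 0).
  { intros x Hx Hxt. rewrite eE_phi by lra.
    replace ((t - 7) / (t + 2)) with (- k) by (unfold k; field; lra).
    assert (0 < (x - t)^2) by nra. assert (x * (2 * x + - k) < 0) by nra. nra. }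
  destruct (Req_dec (k / 4) t) as [D|D].
  - exists (k / 8). split; [lra|]. apply K; lra.
  - exists (k / 4). split; [lra|]. apply K; lra.
Qed.

Lemma classify_c4_nonzero f t q :
  extremal f -> c4 f <> 0 -> 0 <= t -> length q = 4%nat ->
  (forall x, peval (phi f) x = (x - t)^2 * peval q x) -> nonneg_ray q ->
  on_listed_ray f.
Proof.
  intros Hf C Ht L E Q. assert (HP := Hf). destruct HP as [HP [F0 _]].
  apply inP_iff in HP as [Hp Hs].
  length_list q L.
  destruct (double_zero_or_positive _ Q) as [[z [p [Hz [L [Eq Qq]]]]]|[Pos Low]].
  { simpl in L. length_list p L.
    apply (classify_two_double_zeros f t z r3 r4); trivial.
    intros x. rewrite E, Eq. simpl. ring. }
  destruct (double_factor_coords _ _ _ _ _ _ E) as [Q3 [Q2 [Q0 [Q4 Q1]]]].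
  assert (Ht1 : t <> 1) by (intros ->; apply C; lra). specialize (Q1 Ht1).
  (* For a cofactor of degree at most 1 the relation makes r0 a negative multiple of r, so both
     would vanish. *)
  assert (Deg : r1 <> 0 \/ r2 <> 0).
  { destruct (Req_dec r1 0) as [D1|?]; [|auto]. destruct (Req_dec r2 0) as [D2|?]; [|auto].
    exfalso. rewrite D1, D2 in *.
    assert (0 <= r) by (specialize (Q 0 ltac:(lra)); simpl in Q; lra).
    assert (0 <= r0).
    { apply (leading_nonneg [r]). intros x Hx. specialize (Q x Hx). simpl in *. lra. }
    specialize (Pos 1 ltac:(lra)). simpl in Pos. nra. }
  assert (H4 : 0 < c4 f) by (specialize (Hp 1 ltac:(lra)); simpl in Hp; lra).
  destruct (double_zero_or_positive _ Hs) as [[w [p [Hw [L [Ew _]]]]]|[SPos SLow]].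
  - simpl in L. length_list p L.
    assert (Er : r3 = c0 f).
    { assert (A0 := Ew 0). assert (A1 := Ew 1). assert (A2 := Ew 2). simpl in A0, A1, A2. lra. }
    subst r3.
    assert (Es : forall x, peval (psi f) x = c0 f * (x - w)^2)
      by (intros; rewrite Ew; simpl; ring).
    assert (Hc0 : 0 < c0 f).
    { assert (0 <= c0 f) by (now apply (leading_nonneg [c0 f + c1 f + c2 f; 3 * c0 f + c1 f])).
      destruct (Req_dec (c0 f) 0) as [Z|Z]; [|lra].
      destruct (psi_zero_coords f) as [_ [Z1 _]]; [intros x _; rewrite Es, Z; ring|].
      rewrite Z, Z1 in *. exfalso. destruct Deg; lra. }
    (* t = 0 forces [psi f] to vanish at 0, so w = 0, and the relation then makes the cofactor
       vanish at 4. *)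
    destruct (Req_dec t 0) as [T0|T0].
    { exfalso. assert (A0 := Es 0). assert (A1 := Es 1). simpl in A0, A1.
      rewrite T0 in *.
      assert (w = 0).
      { assert (W : c0 f * (w * w) = 0) by lra.
        apply Rmult_integral in W as [W|W]; [lra|].
        apply Rmult_integral in W; tauto. }
      subst w. specialize (Pos 4 ltac:(lra)). simpl in Pos. lra. }
    assert (EB : f = scaleH (c0 f) (hB t w))
      by (apply (hB_unique f t w [r; r0; r1; r2]); trivial; lra).
    assert (E4 : c4 f = c0 f * ((t - 1)^3 * slackB t w / (t + 2))).
    { rewrite <- c4_hB by lra. rewrite EB at 1. reflexivity. }
    destruct (Rle_lt_dec t 1) as [T|T].
    + exfalso. destruct (cofactorB_negative t w) as [x [Hx N]]; [lra|exact Hw|].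
      specialize (Pos x ltac:(lra)). specialize (E x). rewrite EB, phi_scale, hB_phi in E by lra.
      assert (0 < (x - t)^2) by nra.
      assert (c0 f * peval (cofactorB t w) x = peval [r; r0; r1; r2] x)
        by (apply Rmult_eq_reg_l with ((x - t)^2); lra).
      nra.
    (* This follows from [c4 f > 0], and it forces t > 2 by the form of [slackB]. *)
    + assert (S : 0 < slackB t w).
      { destruct (Rle_lt_dec (slackB t w) 0) as [S|]; [exfalso|assumption].
        assert (0 < (t - 1)^3 / (t + 2)) by (apply Rdiv_lt_0_compat; [apply pow_lt|]; lra).
        replace ((t - 1)^3 * slackB t w / (t + 2)) with ((t - 1)^3 / (t + 2) * slackB t w)
          in E4 by (field; lra).
        set (b := (t - 1)^3 / (t + 2)) in *.
        assert (0 <= c0 f * (b * - slackB t w))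
          by (apply Rmult_le_pos; [lra|apply Rmult_le_pos; lra]). lra. }
      rewrite EB. apply scaled_on_listed_ray; [exact Hc0|].
      apply hB_listed; trivial; [|lra]. unfold slackB in S.
      assert (0 <= (w / t)^2) by apply pow2_ge_0. lra.
  (* With no further double zero there is room to add and to subtract a multiple of [eE t]: its
     [phi] is (x-t)^2 x (2x+k) and its [psi] is x. Both signs matter, since for t < 7 this form is
     outside the cone. *)
  - destruct (ray_lower_bound 2 [r; r0; r1; r2]) as [e [He B]]; trivial; [lia| |].
    { destruct Deg as [D|D]; [exists 2%nat|exists 3%nat]; (split; [simpl; lia|exact D]). }
    destruct (ray_lower_bound 1 (psi f)) as [e' [He' B']]; trivial.
    { destruct (Req_dec (c0 f) 0) as [Z|Z]; [exists 1%nat|exists 2%nat];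
        (split; [simpl; lia|simpl]); [|exact Z].
      intros Z'. assert (Z1 : c1 f = 0) by lra. rewrite Z, Z1 in Q2. rewrite Z in Q3.
      destruct Deg; lra. }
    set (k := (t - 7) / (t + 2)) in *.
    assert (Hk : Rabs k <= 4).
    { apply Rabs_le. unfold k. split.
      - apply Rmult_le_reg_r with (t + 2); [lra|]. unfold Rdiv.
        rewrite Rmult_assoc, Rinv_l; lra.
      - apply Rmult_le_reg_r with (t + 2); [lra|]. unfold Rdiv.
        rewrite Rmult_assoc, Rinv_l; lra. }
    (* |k| <= 4 gives x |2x+k| <= 4 (x + x^2), whence e/4. *)
    set (d := Rmin (e / 4) e').
    assert (D0 : 0 < d) by (apply Rmin_pos; lra).
    assert (D1 : d <= e / 4) by apply Rmin_l. assert (D2 : d <= e') by apply Rmin_r.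
    destruct (extremal_perturb f (eE t) d) as [l El]; trivial.
    { intros x Hx. rewrite eE_phi, E by lra. fold k.
      replace (d * ((x - t)^2 * (x * (2 * x + k)))) with ((x - t)^2 * (d * (x * (2 * x + k)))) by ring.
      rewrite Rabs_mult, Rabs_right by (apply Rle_ge, pow2_ge_0).
      apply Rmult_le_compat_l; [apply pow2_ge_0|].
      specialize (B x Hx).
      rewrite Rabs_mult, (Rabs_right d), Rabs_mult, (Rabs_right x) by lra.
      assert (Rabs (2 * x + k) <= 2 * x + 4).
      { apply Rle_trans with (1 := Rabs_triang _ _). rewrite (Rabs_right (2 * x)); lra. }
      apply Rle_trans with (e / 4 * (x * (2 * x + 4))).
      - apply Rmult_le_compat; trivial; [lra| |].
        + apply Rmult_le_pos; [exact Hx|apply Rabs_pos].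
        + now apply Rmult_le_compat_l.
      - apply Rle_trans with (2 := B).
        assert (0 <= e * x^2) by (apply Rmult_le_pos; [lra|apply pow2_ge_0]). lra. }
    { intros x Hx. replace (peval (psi (eE t)) x) with x by (simpl; ring).
      specialize (B' x Hx). rewrite pow_1 in B'.
      assert (d * x <= e' * x) by (now apply Rmult_le_compat_r).
      assert (0 <= d * x) by (apply Rmult_le_pos; lra).
      rewrite Rabs_right; lra. }
    assert (l <> 0).
    { intros ->. apply (f_equal c1) in El. simpl in El. lra. }
    assert (Ef : f = scaleH (/ l) (eE t))
      by (rewrite El, scale_scale, Rinv_l, scale_one by assumption; reflexivity).
    assert (Z0 : c0 f = 0) by (rewrite Ef; simpl; ring).
    assert (Z1 : c1 f = / l) by (rewrite Ef; simpl; ring).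
    assert (0 < / l).
    { assert (0 <= r1).
      { apply (leading_nonneg [r; r0]). intros x Hx. specialize (Q x Hx).
        rewrite Q3, Z0 in Q. simpl in *. lra. }
      assert (/ l <> 0) by now apply Rinv_neq_0_compat.
      rewrite Z0, Z1 in Q2. lra. }
    destruct (Rle_lt_dec 7 t) as [T|T].
    + exists (eE t). split; [|exists (/ l); auto].
      do 6 right; left. now exists t.
    + exfalso. destruct (eE_sign t ltac:(lra)) as [x [Hx N]].
      specialize (Hp x ltac:(lra)). rewrite Ef, phi_scale in Hp.
      assert (0 < / l * - peval (phi (eE t)) x) by (apply Rmult_lt_0_compat; lra). lra.
Qed.

Lemma extremal_classification f : extremal f -> on_listed_ray f.
Proof.
  intros Hf. destruct (Req_dec (c4 f) 0) as [C|C]; [now apply classify_c4_zero|].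
  assert (HP := Hf). destruct HP as [HP [F0 _]]. apply inP_iff in HP as [Hp Hs].
  destruct (double_zero_or_positive _ Hp) as [[t [q [Ht [L [E Q]]]]]|[Pos Low]].
  { now apply classify_c4_nonzero with t q. }
  destruct (ray_lower_bound 2 (phi f)) as [e [He B]]; trivial; [lia| |].
  (* If [phi f] had degree at most 1, then c0 = c1 = 0 and c4 = -c2, while the values 3 c4 of [phi]
     at 1 and c2 of [psi] at 0 are both nonnegative. *)
  - apply NNPP. intros N.
    assert (Z : forall i, (2 <= i < 6)%nat -> nth i (phi f) 0 = 0).
    { intros i Hi. apply NNPP. intros Hi'. apply N. now exists i. }
    assert (Z2 := Z 2%nat ltac:(lia)). assert (Z3 := Z 3%nat ltac:(lia)).
    assert (Z4 := Z 4%nat ltac:(lia)). assert (Z5 := Z 5%nat ltac:(lia)).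
    specialize (Hp 1 ltac:(lra)). specialize (Hs 0 ltac:(lra)). simpl in *. lra.
  (* [phi] of s4 is x + 2x^2 <= 2 (x + x^2), whence e/2, and its [psi] is zero. *)
  - apply extremal_above_listed with eEinf (e / 2); trivial; [|lra| |].
    + do 7 right; left. reflexivity.
    + intros x Hx. specialize (B x Hx). simpl in B |- *. nra.
    + intros w Hw. specialize (Hs w Hw). simpl in *. lra.
Qed.

Theorem theorem1p4 :
  forall f : H35,
    extremal f <-> exists g : H35, listed g /\ exists l : R, 0 < l /\ f = scaleH l g.
Proof.
  intros f. split; [apply extremal_classification|].
  intros [g [Hg [l [Hl ->]]]]. apply extremal_scale; [exact Hl|]. now apply listed_extremal.
Qed.
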